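(* Let $R$ be a discrete valuation ring with fraction field $K$, $\Delta$ a maximal $R$-order in a $K$-central division algebra $K\Delta$ with $\Delta/\mathrm{rad}\,\Delta\simeq M_r(D)$ for a division ring $D$, and $\Lambda\subseteq M_n(\Delta)$ a normal hereditary $R$-order in $M_n(K\Delta)$ with exactly $d$ isomorphism classes of simple modules. Then there exist $b\mid r$ and a positive integer $c$ such that $M_b(\Lambda)\simeq M_c(\Delta_d)$.
   Context: $\Lambda$ is normal if its Jacobson radical is free of rank one as a left and as a right $\Lambda$-module. $\Delta_d$ denotes the subring of $M_d(\Delta)$ of matrices with entries in $\Delta$ on and above the diagonal and entries in $\mathrm{rad}\,\Delta$ strictly below the diagonal. *)

(* Defs.v *)
From HB Require Import structures.
From mathcomp Require Import all_boot all_order all_algebra all_field.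
Set Implicit Arguments. Unset Strict Implicit. Unset Printing Implicit Defensive.
Import GRing.Theory.
Local Open Scope ring_scope.

Section RingDefs.
Variable B : pzRingType.

Definition subring_of (S : B -> Prop) :=
  [/\ S 1, (forall x y, S x -> S y -> S (x - y)) & (forall x y, S x -> S y -> S (x * y))].

Definition left_ideal (L I : B -> Prop) :=
  [/\ (forall x, I x -> L x), I 0, (forall x y, I x -> I y -> I (x - y))
    & (forall l x, L l -> I x -> I (l * x))].
Definition right_ideal (L I : B -> Prop) :=
  [/\ (forall x, I x -> L x), I 0, (forall x y, I x -> I y -> I (x - y))
    & (forall l x, L l -> I x -> I (x * l))].

Definition max_left_ideal (L I : B -> Prop) :=
  [/\ left_ideal L I, (exists x, L x /\ ~ I x)
    & (forall J, left_ideal L J -> (forall x, I x -> J x) ->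
        (exists x, L x /\ ~ J x) -> forall x, J x -> I x)].

Definition jrad (L : B -> Prop) (x : B) : Prop :=
  L x /\ forall M, max_left_ideal L M -> M x.

(* I is a finitely generated projective left L-module: a retract of L^m. *)
Definition proj_left (L I : B -> Prop) :=
  exists (m : nat) (p : ('I_m -> B) -> B) (s : B -> 'I_m -> B),
     (forall v, (forall i, L (v i)) -> I (p v))
  /\ (forall v w, (forall i, L (v i)) -> (forall i, L (w i)) ->
        p (fun i => v i + w i) = p v + p w)
  /\ (forall l v, L l -> (forall i, L (v i)) -> p (fun i => l * v i) = l * p v)
  /\ (forall x, I x -> forall i, L (s x i))
  /\ (forall x y, I x -> I y -> forall i, s (x + y) i = s x i + s y i)
  /\ (forall l x, L l -> I x -> forall i, s (l * x) i = l * s x i)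
  /\ (forall x, I x -> p (s x) = x).

Definition proj_right (L I : B -> Prop) :=
  exists (m : nat) (p : ('I_m -> B) -> B) (s : B -> 'I_m -> B),
     (forall v, (forall i, L (v i)) -> I (p v))
  /\ (forall v w, (forall i, L (v i)) -> (forall i, L (w i)) ->
        p (fun i => v i + w i) = p v + p w)
  /\ (forall l v, L l -> (forall i, L (v i)) -> p (fun i => v i * l) = p v * l)
  /\ (forall x, I x -> forall i, L (s x i))
  /\ (forall x y, I x -> I y -> forall i, s (x + y) i = s x i + s y i)
  /\ (forall l x, L l -> I x -> forall i, s (x * l) i = s x i * l)
  /\ (forall x, I x -> p (s x) = x).

Definition hereditary (L : B -> Prop) :=
  (forall I, left_ideal L I -> proj_left L I) /\
  (forall I, right_ideal L I -> proj_right L I).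

(* Normal: rad L is free of rank one as a left and as a right L-module. *)
Definition normal_order (L : B -> Prop) :=
  (exists x, jrad L x /\ (forall y, jrad L y <-> exists l, L l /\ y = l * x)
             /\ (forall l, L l -> l * x = 0 -> l = 0)) /\
  (exists x, jrad L x /\ (forall y, jrad L y <-> exists l, L l /\ y = x * l)
             /\ (forall l, L l -> x * l = 0 -> l = 0)).

Definition quot_iso (L M M' : B -> Prop) :=
  exists f : B -> B,
     (forall x, L x -> L (f x))
  /\ (forall x y, L x -> L y -> M' (f (x + y) - (f x + f y)))
  /\ (forall l x, L l -> L x -> M' (f (l * x) - l * f x))
  /\ (forall x, L x -> (M x <-> M' (f x)))
  /\ (forall y, L y -> exists x, L x /\ M' (f x - y)).

(* L has exactly d isomorphism classes of simple (left) modules; every simple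
   module is L/M for a maximal left ideal M. *)
Definition num_simple_classes (L : B -> Prop) (d : nat) :=
  exists Ms : 'I_d -> B -> Prop,
  [/\ forall i, max_left_ideal L (Ms i),
      forall i j, quot_iso L (Ms i) (Ms j) -> i = j
    & forall M, max_left_ideal L M -> exists i, quot_iso L M (Ms i)].

End RingDefs.

Definition ring_iso (B1 B2 : pzRingType) (S1 : B1 -> Prop) (S2 : B2 -> Prop) :=
  exists f : B1 -> B2,
     (forall x, S1 x -> S2 (f x))
  /\ (forall y, S2 y -> exists x, S1 x /\ f x = y)
  /\ (forall x y, S1 x -> S1 y -> f x = f y -> x = y)
  /\ f 1 = 1
  /\ (forall x y, S1 x -> S1 y -> f (x + y) = f x + f y)
  /\ (forall x y, S1 x -> S1 y -> f (x * y) = f x * f y).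

Definition mx_over (T : Type) (k : nat) (S : T -> Prop) (M : 'M[T]_k) :=
  forall i j, S (M i j).

Section OrderDefs.
Variable K : fieldType.

Definition is_DVR (R : K -> Prop) :=
  [/\ subring_of R,
      (forall x : K, exists a b, [/\ R a, R b, b != 0 & x = a / b])
    & exists pi, [/\ R pi, pi != 0, ~ R pi^-1 &
        forall x, x != 0 -> exists (u : K) (z : int), [/\ R u, R u^-1 & x = u * pi ^ z]]].

(* L is an R-order in the K-algebra B (K acting through sc): a subring that is
   a finitely generated R-submodule with K L = B. *)
Definition is_order (B : pzRingType) (sc : K -> B -> B) (R : K -> Prop) (L : B -> Prop) :=
  [/\ subring_of L,
      (forall r x, R r -> L x -> L (sc r x)),
      (exists s : seq B, (forall x, x \in s -> L x) /\
         forall x, L x -> exists c : seq K,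
           [/\ forall k, k \in c -> R k, size c = size s &
               x = \sum_(i < size s) sc c`_i s`_i])
    & (forall x, exists r, [/\ R r, r != 0 & L (sc r x)])].

Definition max_order (A : falgType K) (R : K -> Prop) (L : A -> Prop) :=
  is_order ( *:%R ) R L /\
  forall G, is_order ( *:%R ) R G -> (forall x, L x -> G x) -> forall x, G x -> L x.

Definition mx_scale (A : falgType K) (n : nat) (k : K) (M : 'M[A]_n) : 'M[A]_n :=
  map_mx ( *:%R k) M.

Definition Delta_d (A : falgType K) (Delta : A -> Prop) (d : nat) (M : 'M[A]_d) :=
  forall i j : 'I_d, ((i <= j)%N -> Delta (M i j)) /\ ((j < i)%N -> jrad Delta (M i j)).

End OrderDefs.

(* Main.v *)
Require Import Defs.
From mathcomp Require Import all_boot all_algebra all_field.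
From Stdlib Require Import Classical ClassicalEpsilon FunctionalExtensionality.
Set Implicit Arguments.
Unset Strict Implicit.
Unset Printing Implicit Defensive.
Import GRing.Theory.
Local Open Scope ring_scope.

(* Put G = M_n(Delta) and P = M_n(rad Delta), and let rad Lambda = x Lambda with x
   invertible.  The lattices L_i = x^i G form a descending chain of
   (Lambda, G)-bimodules with rad Lambda * L_i = L_(i+1), and heredity gives each L_i
   a dual basis over Lambda.  Hence every Lambda-submodule between L_(i+1) and L_i has
   a complement, and lifting the projection onto it shows, as P is the largest proper
   ideal of G, that the layer L_i / L_(i+1) is a simple bimodule.  With Nakayama's
   lemma this forces P = L_e for some e > 0.  The simple quotients of L_0, ..., L_(e-1)
   represent all simple Lambda-modules exactly once, so e = d, and the trace ideals of
   the L_i together generate Lambda, so Lambda is the stabiliser of the chain.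

   As Delta / rad Delta = M_r(D), the quotient Delta^n / x Delta^n is a sum of m copies
   of the simple right module D^r.  With b = r / gcd(m, r) and c = m / gcd(m, r), b
   copies of it form a free module of rank c over Delta / rad Delta.  If F lifts a
   basis and X is the block diagonal matrix of b copies of x, then
   (X^(d-1) F, ..., X F, F) is a basis of Delta^(nb) adapted to the chain, and
   conjugating by it turns M_b(Lambda) into M_c(Delta_d). *)

(** * Additive subgroups, submodules and ideals *)

Definition subgroup_of (V : zmodType) (N : V -> Prop) :=
  N 0 /\ forall x y, N x -> N y -> N (x - y).

Section Subgroups.
Variables (V : zmodType) (N : V -> Prop).
Hypothesis gN : subgroup_of N.

Lemma subgroup0 : N 0. Proof. by case: gN. Qed.

Lemma subgroupB x y : N x -> N y -> N (x - y).
Proof. by case: gN => _; apply. Qed.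

Lemma subgroupN x : N x -> N (- x).
Proof. by move=> Nx; rewrite -sub0r; apply: subgroupB => //; apply: subgroup0. Qed.

Lemma subgroupD x y : N x -> N y -> N (x + y).
Proof. by move=> Nx Ny; rewrite -[y]opprK; apply/subgroupB/subgroupN. Qed.

Lemma subgroup_sum (I : Type) (r : seq I) (Q : pred I) (F : I -> V) :
  (forall i, Q i -> N (F i)) -> N (\sum_(i <- r | Q i) F i).
Proof. by move=> NF; apply: big_ind => //; [apply: subgroup0 | apply: subgroupD]. Qed.

Lemma subgroupBl x y : N (x - y) -> N y -> N x.
Proof. by move=> Nxy Ny; rewrite -[x](subrK y); apply: subgroupD. Qed.

Lemma subgroupBr x y : N (x - y) -> N x -> N y.
Proof. by move=> Nxy Nx; rewrite -[y](subKr x); apply: subgroupB. Qed.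

End Subgroups.

Lemma subrACA (V : zmodType) (a b c d : V) : a - b - (c - d) = a - c - (b - d).
Proof. by rewrite !opprB addrACA [RHS]addrACA [- b + _]addrC. Qed.

Definition sum_of (V : zmodType) (M N : V -> Prop) (v : V) :=
  exists2 u, M u & N (v - u).

Section SubgroupOperations.
Variables (V : zmodType) (M N : V -> Prop).
Hypotheses (gM : subgroup_of M) (gN : subgroup_of N).

Lemma sum_ofl v : M v -> sum_of M N v.
Proof. by move=> Mv; exists v => //; rewrite subrr; apply: subgroup0. Qed.

Lemma sum_ofr v : N v -> sum_of M N v.
Proof. by move=> Nv; exists 0; rewrite ?subr0 //; apply: subgroup0. Qed.

Lemma subgroup_sum_of : subgroup_of (sum_of M N).
Proof.
split=> [|x y [u Mu Nu] [w Mw Nw]]; first by apply: sum_ofl; apply: subgroup0 gM.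
by exists (u - w); rewrite 1?subrACA; apply: subgroupB.
Qed.

Lemma subgroup_cap : subgroup_of (fun v => M v /\ N v).
Proof.
split=> [|x y [Mx Nx] [My Ny]]; first by split; apply: subgroup0.
by split; apply: subgroupB.
Qed.

End SubgroupOperations.

Definition additive_on (V W : zmodType) (N : V -> Prop) (f : V -> W) :=
  forall x y, N x -> N y -> f (x + y) = f x + f y.

Section AdditiveOn.
Variables (V W : zmodType) (N : V -> Prop) (f : V -> W).
Hypotheses (gN : subgroup_of N) (fD : additive_on N f).

Lemma additive_on0 : f 0 = 0.
Proof. by apply: (addrI (f 0)); rewrite -fD ?addr0 //; apply: subgroup0. Qed.

Lemma additive_onB x y : N x -> N y -> f (x - y) = f x - f y.
Proof.
by move=> Nx Ny; apply: (addIr (f y)); rewrite -fD ?subrK //; apply: subgroupB.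
Qed.

Lemma additive_on_sum (I : finType) (F : I -> V) :
  (forall i, N (F i)) -> f (\sum_i F i) = \sum_i f (F i).
Proof.
move=> NF; suff [] : N (\sum_i F i) /\ f (\sum_i F i) = \sum_i f (F i) by [].
elim/big_rec2: _ => [|i y z _ [Nz <-]].
  by split; [apply: subgroup0 | apply: additive_on0].
by split; [apply: subgroupD | rewrite fD].
Qed.

End AdditiveOn.

Definition lstable (B : pzRingType) (S N : B -> Prop) :=
  forall s x, S s -> N x -> N (s * x).

Definition rstable (B : pzRingType) (S N : B -> Prop) :=
  forall s x, S s -> N x -> N (x * s).

Definition lsubmodule (B : pzRingType) (S N : B -> Prop) :=
  subgroup_of N /\ lstable S N.

Definition ideal_of (B : pzRingType) (S I : B -> Prop) :=
  [/\ forall x, I x -> S x, subgroup_of I, lstable S I & rstable S I].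

(* Naming convention: for a subset [X] of a ring, [sX], [gX], [lX], [rX], [mX], [iX]
   and [qX] say that [X] is a subring, subgroup, left stable, right stable, left
   submodule, ideal and quasiregular, respectively. *)

Definition lmul_of (B : pzRingType) (a : B) (N : B -> Prop) (v : B) :=
  exists2 u, N u & v = a * u.

Definition rmul_of (B : pzRingType) (N : B -> Prop) (a : B) (v : B) :=
  exists2 u, N u & v = u * a.

Lemma exprVK (B : pzRingType) (x y : B) k : y * x = 1 -> y ^+ k * x ^+ k = 1.
Proof.
move=> yx; elim: k => [|k IHk]; first by rewrite !expr0 mulr1.
by rewrite exprSr exprS mulrA -(mulrA _ y) yx mulr1.
Qed.

Section Submodules.
Variables (B : pzRingType) (S : B -> Prop).
Implicit Types (M N : B -> Prop) (a : B).

Lemma lmul_subgroup N a : subgroup_of N -> subgroup_of (lmul_of a N).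
Proof.
move=> gN; split=> [|_ _ [u Nu ->] [v Nv ->]].
  by exists 0; rewrite ?mulr0 //; apply: subgroup0.
by exists (u - v); rewrite ?mulrBr //; apply: subgroupB.
Qed.

Lemma lmul_rstable N a : rstable S N -> rstable S (lmul_of a N).
Proof. by move=> rN s _ Ss [u Nu ->]; exists (u * s); rewrite ?mulrA //; apply: rN. Qed.

Lemma lsubmodule_rmul N a : lsubmodule S N -> lsubmodule S (rmul_of N a).
Proof.
move=> [gN lN]; split; first split=> [|_ _ [u Nu ->] [v Nv ->]].
- by exists 0; rewrite ?mul0r //; apply: subgroup0.
- by exists (u - v); rewrite ?mulrBl //; apply: subgroupB.
- by move=> s _ Ss [u Nu ->]; exists (s * u); rewrite ?mulrA //; apply: lN.
Qed.

Lemma lsubmodule_preim_mulr N a :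
  lsubmodule S N -> lsubmodule S (fun v => N (v * a)).
Proof.
move=> [gN lN]; split; first split=> [|u v Nu Nv].
- by rewrite mul0r; apply: subgroup0.
- by rewrite mulrBl; apply: subgroupB.
- by move=> s v Ss Nv; rewrite -mulrA; apply: lN.
Qed.

Lemma lsubmodule_cap M N :
  lsubmodule S M -> lsubmodule S N -> lsubmodule S (fun v => M v /\ N v).
Proof.
move=> [gM lM] [gN lN]; split; first exact: subgroup_cap.
by move=> s v Ss [Mv Nv]; split; [apply: lM | apply: lN].
Qed.

Lemma lsubmodule_sum M N :
  lsubmodule S M -> lsubmodule S N -> lsubmodule S (sum_of M N).
Proof.
move=> [gM lM] [gN lN]; split; first exact: subgroup_sum_of.
by move=> s v Ss [u Mu Nu]; exists (s * u); rewrite -?mulrBr; [apply: lM | apply: lN].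
Qed.

Lemma rstable_sum M N : rstable S M -> rstable S N -> rstable S (sum_of M N).
Proof.
move=> rM rN s v Ss [u Mu Nu].
by exists (u * s); rewrite -?mulrBl; [apply: rM | apply: rN].
Qed.

Lemma lsubmoduleW T N :
  (forall s, S s -> T s) -> lsubmodule T N -> lsubmodule S N.
Proof. by move=> ST [gN lN]; split=> // s v /ST; apply: lN. Qed.

Lemma left_idealP I :
  left_ideal S I <-> (forall x, I x -> S x) /\ lsubmodule S I.
Proof. by split=> [[IS I0 IB lI]|[IS [[I0 IB] lI]]]. Qed.

Hypothesis sS : subring_of S.

Lemma subring_subgroup : subgroup_of S.
Proof. by case: sS => S1 SB _; split=> //; rewrite -(subrr 1); apply: SB. Qed.

Lemma subring_lsubmodule : lsubmodule S S.
Proof. by split; [apply: subring_subgroup | case: sS]. Qed.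

Lemma subring_nat (b : bool) : S b%:R.
Proof. by case: b; [case: sS | apply: subgroup0 subring_subgroup]. Qed.

Lemma subringX x k : S x -> S (x ^+ k).
Proof.
by move=> Sx; case: sS => S1 _ SM; elim: k => [|k IHk]; rewrite ?expr0 ?exprS //; apply: SM.
Qed.

End Submodules.

(** * Nakayama's lemma *)

Definition left_quasiregular (B : pzRingType) (S J : B -> Prop) :=
  forall j, J j -> exists2 s, S s & s * (1 - j) = 1.

Definition span_of (B : pzRingType) (V : lmodType B) (J : B -> Prop) (m : nat)
    (l : 'I_m -> V) (v : V) :=
  exists2 a, forall i, J (a i) & v = \sum_i a i *: l i.

Section Nakayama.
Variables (B : pzRingType) (S J : B -> Prop).
Hypotheses (sS : subring_of S) (JS : forall x, J x -> S x).
Hypotheses (mJ : lsubmodule S J) (qJ : left_quasiregular S J).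

Let SJ : lstable S J. Proof. by case: mJ. Qed.
Let gJ : subgroup_of J. Proof. by case: mJ. Qed.
Let SM : lstable S S. Proof. by case: sS. Qed.

Lemma quasiregular_inv j : J j -> exists2 s, S s & s * (1 - j) = 1 /\ (1 - j) * s = 1.
Proof.
move=> Jj; have [s Ss s1] := qJ Jj; exists s => //; split=> //.
have sE : 1 - - (s * j) = s by rewrite opprK -{1}s1 mulrBr mulr1 subrK.
have [|t _] := qJ (j := - (s * j)); first exact/(subgroupN gJ)/SJ.
rewrite sE => ts; suff <- : t = 1 - j by [].
by rewrite -[LHS]mulr1 -{1}s1 mulrA ts mul1r.
Qed.

Lemma quasiregular_proper : (1 : B) <> 0 -> ~ J 1.
Proof. by move=> B1 /qJ [s _]; rewrite subrr mulr0 => /esym. Qed.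

Lemma nakayama (V : lmodType B) (N : V -> Prop) m (l : 'I_m -> V) :
  subgroup_of N -> (forall s v, S s -> N v -> N (s *: v)) ->
  (forall k, sum_of N (span_of J l) (l k)) -> forall k, N (l k).
Proof.
move=> gN SN; elim: m l => [|m IHm] l cov; first by case.
have [n0 Nn0 [a Ja]] := cov ord0; rewrite big_ord_recl => l0E.
have [s Ss s1] := qJ (Ja ord0).
pose l' i := l (lift ord0 i).
have {}l0E : l ord0 = s *: n0 + \sum_i (s * a (lift ord0 i)) *: l' i.
  rewrite -[LHS]scale1r -s1 -scalerA scalerBl scale1r.
  rewrite -[X in X - _](subrK n0) l0E -[X in X - _]addrA.
  rewrite [X in _ *: X]addrC addKr scalerDr addrC scaler_sumr.
  by congr (_ + _); apply: eq_bigr => i _; rewrite scalerA.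
have Nl' : forall i, N (l' i).
  apply: IHm => k; have [n Nn [b Jb]] := cov (lift ord0 k).
  rewrite big_ord_recl l0E scalerDr scalerA -addrA => lkE.
  have Sb0s : S (b ord0 * s) by apply: SM => //; apply: JS.
  exists (n + (b ord0 * s) *: n0); first by apply: subgroupD => //; apply: SN.
  exists (fun i => b ord0 * s * a (lift ord0 i) + b (lift ord0 i)).
    by move=> i; apply: subgroupD => //; apply: SJ.
  rewrite opprD addrA lkE addrC addKr scaler_sumr -big_split.
  by apply: eq_bigr => i _; rewrite /= scalerA mulrA scalerDl.
move=> k; case: (unliftP ord0 k) => [i ->|->]; first exact: Nl'.
rewrite l0E; apply: subgroupD => //; first exact: SN.
by apply: subgroup_sum => // i _; apply: SN => //; apply: SM => //; apply: JS.
Qed.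

End Nakayama.

(** * Maximal left ideals *)

Section MaximalLeftIdeals.
Variables (B : pzRingType) (L : B -> Prop).
Hypothesis sL : subring_of L.

Let L1 : L 1. Proof. by case: sL. Qed.
Let LM : lstable L L. Proof. by case: sL. Qed.
Let gL : subgroup_of L := subring_subgroup sL.

Lemma left_ideal1 I x : left_ideal L I -> I 1 -> L x -> I x.
Proof. by case=> _ _ _ LI I1 Lx; rewrite -[x]mulr1; apply: LI. Qed.

Lemma max_left_ideal_lsubmodule M : max_left_ideal L M -> lsubmodule L M.
Proof. by case=> /left_idealP []. Qed.

Lemma max_left_ideal_proper M : max_left_ideal L M -> ~ M 1.
Proof. by move=> [iM [x [Lx nMx]] _] M1; apply/nMx/(left_ideal1 iM). Qed.

Lemma max_left_ideal_inv M y :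
  max_left_ideal L M -> L y -> ~ M y -> exists2 l, L l & M (l * y - 1).
Proof.
move=> maxM Ly nMy; have mM := max_left_ideal_lsubmodule maxM; have [gM _] := mM.
have [iM _ topM] := maxM; have [ML _] := proj1 (left_idealP _ _) iM.
have mLy : lsubmodule L (rmul_of L y) by apply: lsubmodule_rmul.
have gLy : subgroup_of (rmul_of L y) by case: mLy.
have iJ : left_ideal L (sum_of (rmul_of L y) M).
  apply/left_idealP; split; last exact: lsubmodule_sum.
  by move=> z [_ [l Ll ->]] /ML Lz; apply: (subgroupBl gL Lz); apply: LM.
apply: NNPP => noinv; case: nMy; apply: (topM _ iJ).
- exact: (sum_ofr gLy).
- exists 1; split=> // -[_ [l Ll ->]] M1l; apply: noinv; exists l => //.
  by rewrite -opprB; apply: subgroupN.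
- by apply: (sum_ofl gM); exists 1; rewrite ?mul1r.
Qed.

Lemma jrad_lsubmodule : lsubmodule L (jrad L).
Proof.
split; first split; first by split; [apply: subgroup0 | move=> M [[]]].
- move=> x y [Lx Mx] [Ly My]; split; first exact: subgroupB.
  move=> M maxM; have [gM _] := max_left_ideal_lsubmodule maxM.
  by apply: subgroupB => //; [apply: Mx | apply: My].
- move=> s x Ls [Lx Mx]; split; first exact: LM.
  move=> M maxM; have [_ lM] := max_left_ideal_lsubmodule maxM.
  by apply: lM => //; apply: Mx.
Qed.

Lemma not_jrad y : L y -> ~ jrad L y -> exists2 M, max_left_ideal L M & ~ M y.
Proof.
move=> Ly nJy; apply: NNPP => noM; apply: nJy; split=> // M maxM.
by apply: NNPP => nMy; apply: noM; exists M.
Qed.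

Lemma quot_iso_mulr M M' c :
  max_left_ideal L M -> max_left_ideal L M' -> L c ->
  (forall m, M m -> M' (m * c)) -> ~ M' c -> quot_iso L M M'.
Proof.
move=> maxM maxM' Lc MM' nM'c.
have [gM' lM'] := max_left_ideal_lsubmodule maxM'.
have [s Ls sc1] := max_left_ideal_inv maxM' Lc nM'c.
exists (fun l => l * c); do 4?split.
- by move=> l Ll; apply: LM.
- by move=> l k _ _; rewrite mulrDl subrr; apply: subgroup0.
- by move=> l k _ _; rewrite mulrA subrr; apply: subgroup0.
- move=> l Ll; split=> [|M'lc]; first exact: MM'.
  apply: NNPP => nMl; have [t Lt tl1] := max_left_ideal_inv maxM Ll nMl.
  apply: nM'c; apply: (subgroupBr gM' (x := t * (l * c))); last exact: lM'.
  by rewrite mulrA -[X in _ - X]mul1r -mulrBl; apply: MM'.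
- move=> y Ly; exists (y * s); split; first exact: LM.
  by rewrite -[y in _ - y]mulr1 -mulrA -mulrBr; apply: lM'.
Qed.

End MaximalLeftIdeals.

(** * Orders over a discrete valuation ring *)

Definition uniformizer (K : fieldType) (R : K -> Prop) (p : K) :=
  [/\ R p, p != 0, ~ R p^-1 &
     forall x, x != 0 -> exists (u : K) (z : int), [/\ R u, R u^-1 & x = u * p ^ z]].

Section DVR.
Variables (K : fieldType) (R : K -> Prop) (p : K).
Hypotheses (sR : subring_of R) (pR : uniformizer R p).

Let RM : lstable R R. Proof. by case: sR. Qed.
Let R0 : R 0. Proof. exact: subgroup0 (subring_subgroup sR). Qed.

Lemma uniformizer_unit_or_dvd x : x != 0 -> R x^-1 \/ R (x / p).
Proof.
case: pR => Rp p0 _ valp /valp [u [z [Ru Ru1 ->]]].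
case: z => [[|k]|k].
- by left; rewrite expr0z mulr1.
- by right; rewrite -exprnP exprSr mulrA mulfK //; apply: RM => //; apply: subringX.
- by left; rewrite NegzE -exprnN invfM invrK; apply: RM => //; apply: subringX.
Qed.

Lemma uniformizer_clear_denominator x : exists t, R (p ^+ t * x).
Proof.
case: (eqVneq x 0) => [->|x0]; first by exists 0%N; rewrite mulr0.
case: pR => Rp p0 _ /(_ x x0) [u [[k|k] [Ru Ru1 ->]]].
  by exists 0%N; rewrite mul1r -exprnP; apply: RM => //; apply: subringX.
by exists k.+1; rewrite NegzE -exprnN mulrCA divff ?expf_neq0 // mulr1.
Qed.

Lemma uniformizer_1B_unit c : R c -> 1 - p * c != 0 /\ R (1 - p * c)^-1.
Proof.
case: pR => Rp p0 pV1 _ Rc; have n0 : 1 - p * c != 0.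
  by apply/eqP => /subr0_eq E; apply: pV1; rewrite -[p^-1]mulr1 E mulKf.
split=> //; case: (uniformizer_unit_or_dvd n0) => // Rd; case: pV1.
have -> : p^-1 = (1 - p * c) / p + c.
  by rewrite mulrBl mul1r mulrAC divff // mul1r subrK.
by apply: subgroupD => //; apply: subring_subgroup.
Qed.

Lemma first_min_valuation n (a : nat -> K) :
  (exists2 k, (k < n)%N & a k != 0) ->
  exists k, [/\ (k < n)%N, a k != 0, forall j, (j < n)%N -> R (a j / a k)
    & forall j, (j < k)%N -> R (a j / a k / p)].
Proof.
have [R1 _ _] := sR; have [Rp p0 _ _] := pR.
elim: n => [|n IHn] [k0 k0n ak0]; first by [].
case: (classic (exists2 k, (k < n)%N & a k != 0)) => [/IHn|zero].
- move=> [k [kn ak Rk Rkp]]; case: (classic (R (a n / a k))) => [Rn|nRn].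
    exists k; split=> [|//|j|//]; first exact: leqW.
    by rewrite ltnS leq_eqVlt => /orP [/eqP ->|/Rk].
  have an : a n != 0 by apply/eqP => an; case: nRn; rewrite an mul0r.
  have Rkn : R (a k / a n / p).
    have kn0 : a k / a n != 0 by rewrite mulf_neq0 ?invr_neq0.
    by case: (uniformizer_unit_or_dvd kn0) => //; rewrite invf_div.
  have Rjp j : (j < n)%N -> R (a j / a n / p).
    move=> jn; rewrite (_ : _ / p = a j / a k * (a k / a n / p)); first exact/RM/Rkn/Rk.
    by rewrite !mulrA divfK.
  exists n; split=> // j; rewrite ltnS leq_eqVlt => /orP [/eqP ->|jn].
    by rewrite divff.
  by rewrite -[_ / a n](divfK p0) mulrC; apply: RM => //; apply: Rjp.
- have a0 j : (j < n)%N -> a j = 0.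
    by move=> jn; apply/eqP; apply: contra_notT zero => aj; exists j.
  have k0E : k0 = n.
    by move: k0n; rewrite ltnS leq_eqVlt => /orP [/eqP //|/a0 E]; rewrite E eqxx in ak0.
  rewrite -k0E in a0 *; exists k0; split=> // j; last by move/a0 ->; rewrite !mul0r.
  by rewrite ltnS leq_eqVlt => /orP [/eqP ->|/a0 ->]; rewrite ?divff ?mul0r.
Qed.

End DVR.

Lemma minimal_of_no_descending_chain (T : Type) (r : T -> T -> Prop) (t0 : T) :
  (forall f : nat -> T, ~ forall k, r (f k.+1) (f k)) ->
  exists t, forall t', ~ r t' t.
Proof.
move=> nochain; apply: NNPP => nomin.
pose f t := epsilon (inhabits t0) (r ^~ t).
have fP t : r (f t) t.
  apply: (epsilon_spec (inhabits t0) (r ^~ t)); apply: NNPP => nt.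
  by apply: nomin; exists t => t' rt'; apply: nt; exists t'.
by apply: (nochain (fun k => iter k f t0)) => k; apply: fP.
Qed.

Definition strict_sub (V : Type) (M N : V -> Prop) :=
  (forall v, M v -> N v) /\ exists v, N v /\ ~ M v.

Lemma not_strict_sub (V : Type) (M N : V -> Prop) :
  ~ strict_sub M N -> (forall v, M v -> N v) -> forall v, N v -> M v.
Proof. by move=> nMN MN v Nv; apply: NNPP => nMv; apply: nMN; split=> //; exists v. Qed.

Section Order.
Variables (K : fieldType) (R : K -> Prop) (p : K) (B : pzRingType).
Variable iota : {rmorphism K -> B}.
Hypotheses (sR : subring_of R) (pR : uniformizer R p).
Hypothesis iotaC : forall k x, iota k * x = x * iota k.

Definition central_order := is_order (fun k x => iota k * x) R.

Definition dim_le (m : nat) := forall y : nat -> B, exists2 a : nat -> K,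
  exists2 k, (k < m.+1)%N & a k != 0 & \sum_(k < m.+1) iota (a k) * y k = 0.

Lemma iota_invK k x : k != 0 -> iota k^-1 * (iota k * x) = x.
Proof. by move=> k0; rewrite mulrA -rmorphM mulVf // rmorph1 mul1r. Qed.

Lemma order_dim_le L : central_order L -> exists m, dim_le m.
Proof.
case=> _ _ [s [_ sP]] LK; exists (size s) => y.
have span (x : B) : exists c : 'I_(size s) -> K, x = \sum_i iota (c i) * s`_i.
  have [r [_ r0 /sP [c [_ _ xE]]]] := LK x; exists (fun i => r^-1 * c`_i).
  rewrite -[LHS](iota_invK x r0) xE mulr_sumr.
  by apply: eq_bigr => i _; rewrite mulrA -rmorphM.
have [c cE] := fin_all_exists (fun k : 'I_(size s).+1 => span (y k)).
pose C := \matrix_(k, i) c k i.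
have : kermx C != 0 by rewrite kermx_eq0 /row_free neq_ltn ltnS rank_leq_col.
case/rowV0Pn=> v /sub_kermxP vC /rV0Pn [k vk].
exists (fun k => v 0 (inord k)); first by exists k => //; rewrite inord_val.
transitivity (\sum_(i < size s) iota ((v *m C) 0 i) * s`_i); last first.
  by rewrite vC big1 // => i _; rewrite mxE rmorph0 mul0r.
under eq_bigr => j _ do rewrite cE mulr_sumr.
rewrite exchange_big; apply: eq_bigr => i _; rewrite mxE rmorph_sum mulr_suml.
by apply: eq_bigr => j _; rewrite inord_val !mxE rmorphM mulrA.
Qed.

Definition scalars (b : B) := exists2 r, R r & b = iota r.

Definition sublattice (X U : B -> Prop) :=
  [/\ lsubmodule scalars U, (forall x, U x -> X x) & forall x, X x -> U (iota p * x)].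

(* In a nontrivial relation between the [y k], normalised so that the first
   coefficient of least valuation is 1, all other terms lie in the next lattice. *)
Lemma no_long_sublattice_chain m X (I : nat -> B -> Prop) :
  dim_le m -> (forall k, sublattice X (I k)) ->
  ~ forall k, (k < m.+1)%N -> strict_sub (I k.+1) (I k).
Proof.
move=> dim_m subI decI.
pose y k := epsilon (inhabits 0) (fun z => I k z /\ ~ I k.+1 z).
have yP k : (k < m.+1)%N -> I k (y k) /\ ~ I k.+1 (y k).
  move=> km; apply: (epsilon_spec (inhabits 0) (fun z => I k z /\ ~ I k.+1 z)).
  by case: (decI k km).
have Ile i j x : (i <= j)%N -> (j <= m.+1)%N -> I j x -> I i x.
  move=> /subnK <-; elim: (j - i)%N => [//|d IHd]; rewrite addSn => dm Ix.
  by apply: IHd (ltnW dm) _; case: (decI _ dm) => + _; apply.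
have [a nza rel_a] := dim_m y.
have [k [km ak Rk Rkp]] := first_min_valuation sR pR nza.
have [_ nIyk] := yP k km; apply: nIyk; have [[gI lI] _ pI] := subI k.+1.
have -> : y k = - \sum_(j < m.+1 | j != k :> nat) iota (a j / a k) * y j.
  apply/eqP; rewrite -addr_eq0; apply/eqP.
  transitivity (iota (a k)^-1 * \sum_(j < m.+1) iota (a j) * y j).
    rewrite mulr_sumr [RHS](bigD1 (Ordinal km)) //= iota_invK //; congr (_ + _).
    by apply: eq_bigr => j _; rewrite mulrA -rmorphM mulrC.
  by rewrite rel_a mulr0.
apply: (subgroupN gI); apply: (subgroup_sum gI) => j jk.
have [Iyj _] := yP j (ltn_ord j).
case: (ltngtP j k) => [jk'|kj|jk']; last by rewrite jk' eqxx in jk.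
  have p0 : p != 0 by case: pR.
  rewrite -(divfK p0 (a j / a k)) rmorphM -mulrA.
  apply: lI; first by exists (a j / a k / p) => //; apply: Rkp.
  by apply: pI; case: (subI j) => _ + _; apply.
apply: lI; last exact: (Ile _ _ _ kj (ltnW (ltn_ord j)) Iyj).
by exists (a j / a k) => //; apply: Rk.
Qed.

Section ExtremalSublattices.
Variables (m : nat) (X : B -> Prop) (Q : (B -> Prop) -> Prop).
Hypotheses (dim_m : dim_le m) (QX : forall U, Q U -> sublattice X U).

Lemma minimal_sublattice U0 : Q U0 ->
  exists2 U, Q U & forall U', Q U' -> (forall x, U' x -> U x) -> forall x, U x -> U' x.
Proof.
move=> QU0; pose r (U' U : {U | Q U}) := strict_sub (sval U') (sval U).
have [f fP|[U QU] minU] := minimal_of_no_descending_chain (r := r) (exist Q U0 QU0).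
  apply: (no_long_sublattice_chain (m := m) (I := fun k => sval (f k)) dim_m) => [k|k _].
    by apply: QX; case: (f k).
  exact: fP.
by exists U => // U' QU'; apply: not_strict_sub; apply: (minU (exist Q U' QU')).
Qed.

Lemma maximal_sublattice U0 : Q U0 ->
  exists2 U, Q U & forall U', Q U' -> (forall x, U x -> U' x) -> forall x, U' x -> U x.
Proof.
move=> QU0; pose r (U' U : {U | Q U}) := strict_sub (sval U) (sval U').
have [f fP|[U QU] maxU] := minimal_of_no_descending_chain (r := r) (exist Q U0 QU0).
  apply: (no_long_sublattice_chain (m := m) (I := fun k => sval (f (m.+1 - k)%N)) dim_m).
    by move=> k; apply: QX; case: (f _).
  by move=> k km; have := fP (m.+1 - k.+1)%N; rewrite subnSK.
by exists U => // U' QU'; apply: not_strict_sub; apply: (maxU (exist Q U' QU')).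
Qed.

End ExtremalSublattices.

Lemma scalars_subring : subring_of scalars.
Proof.
case: sR => R1 RB RM; split; first by exists 1; rewrite ?rmorph1.
- by move=> _ _ [a Ra ->] [b Rb ->]; exists (a - b); rewrite ?rmorphB //; apply: RB.
- by move=> _ _ [a Ra ->] [b Rb ->]; exists (a * b); rewrite ?rmorphM //; apply: RM.
Qed.

Let p_scalars := rmul_of scalars (iota p).

Lemma uniformizer_scalars x : p_scalars x -> scalars x.
Proof.
case: pR sR => Rp _ _ _ [_ _ RM] [_ [r Rr ->] ->].
by exists (r * p); rewrite ?rmorphM //; apply: RM.
Qed.

Lemma uniformizer_quasiregular : left_quasiregular scalars p_scalars.
Proof.
move=> _ [_ [r Rr ->] ->]; have [n0 Rn] := uniformizer_1B_unit sR pR Rr.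
exists (iota (1 - p * r)^-1); first by exists (1 - p * r)^-1.
have -> : 1 - iota r * iota p = iota (1 - p * r) by rewrite rmorphB rmorph1 rmorphM iotaC.
by rewrite -rmorphM mulVf // rmorph1.
Qed.

(** * The Jacobson radical of an order *)

Section Jacobson.
Variable L : B -> Prop.
Hypothesis oL : central_order L.

Let sL : subring_of L. Proof. by case: oL. Qed.
Let L1 : L 1. Proof. by case: sL. Qed.
Let LM : lstable L L. Proof. by case: sL. Qed.
Let gL : subgroup_of L := subring_subgroup sL.

Lemma order_scalars s : scalars s -> L s.
Proof. by case: oL => _ LR _ _ [r Rr ->]; rewrite -[iota r]mulr1; apply: LR. Qed.

Lemma order_uniformizer : L (iota p).
Proof. by apply: order_scalars; exists p => //; case: pR. Qed.

Lemma lsubmodule_scalars N : lsubmodule L N -> lsubmodule scalars N.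
Proof. exact/lsubmoduleW/order_scalars. Qed.

Lemma left_ideal_uniformizer_nakayama I :
  left_ideal L I -> sum_of I (rmul_of L (iota p)) 1 -> I 1.
Proof.
move=> iI I1p; have [_ mI] := proj1 (left_idealP _ _) iI; have [gI lI] := mI.
have cov x : L x -> sum_of I (rmul_of L (iota p)) x.
  move=> Lx; rewrite -[x]mulr1.
  suff [_] : lsubmodule L (sum_of I (rmul_of L (iota p))) by apply.
  by apply: lsubmodule_sum => //; apply: lsubmodule_rmul.
have [_ _ [s [sL1 sP]] _] := oL.
have Is : forall k : 'I_(size s), I s`_k.
  have mp : lsubmodule scalars p_scalars.
    exact/lsubmodule_rmul/subring_lsubmodule/scalars_subring.
  have qp := uniformizer_quasiregular.
  apply: (nakayama (V := B^o) scalars_subring uniformizer_scalars mp qp gI).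
    by move=> a v /order_scalars La; apply: lI.
  move=> k; have [|i Ii [l Ll E]] := cov s`_k; first by apply/sL1/mem_nth.
  exists i => //; have [c [cR cs lE]] := sP l Ll.
  exists (fun j : 'I__ => iota c`_j * iota p).
    move=> j; exists (iota c`_j) => //; exists c`_j => //.
    by apply/cR/mem_nth; rewrite cs.
  rewrite E lE mulr_suml; apply: eq_bigr => j _.
  by rewrite -mulrA -iotaC mulrA.
have [c [cR cs ->]] := sP 1 L1; apply: (subgroup_sum gI) => j _.
by apply: lI => //; apply: order_scalars; exists c`_j => //; apply/cR/mem_nth; rewrite cs.
Qed.

Lemma left_ideal_in_max I : left_ideal L I -> ~ I 1 ->
  exists2 M, max_left_ideal L M & forall x, I x -> M x.
Proof.
move=> iI nI1; have [IL mI] := proj1 (left_idealP _ _) iI.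
have [m dim_m] := order_dim_le oL; have Lp := order_uniformizer.
have mLp : lsubmodule L (rmul_of L (iota p)) by apply: lsubmodule_rmul.
have [gI _] := mI; have [gLp _] := mLp.
pose I' := sum_of I (rmul_of L (iota p)).
pose Q U := [/\ left_ideal L U, (forall x, I' x -> U x) & ~ U 1].
have QL U : Q U -> sublattice L U.
  move=> [/left_idealP [UL mU] I'U _]; split=> //; first exact: lsubmodule_scalars.
  by move=> x Lx; apply: I'U; apply: (sum_ofr gI); exists x.
have QI' : Q I'.
  split=> //; last by move/(left_ideal_uniformizer_nakayama iI).
  apply/left_idealP; split; last exact: lsubmodule_sum.
  by move=> x [u Iu [l Ll E]]; apply: (subgroupBl gL (y := u)); rewrite ?E; auto.
have [M [iM I'M nM1] topM] := maximal_sublattice dim_m QL QI'.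
exists M => [|x Ix]; last by apply/I'M/(sum_ofl gLp).
split=> //; first by exists 1.
move=> J iJ MJ [x [Lx nJx]]; apply: topM => //; split=> // [y /I'M /MJ //|J1].
exact/nJx/(left_ideal1 iJ).
Qed.

Lemma jrad_quasiregular : left_quasiregular L (jrad L).
Proof.
move=> j [Lj Mj]; apply: NNPP => noinv.
have iI : left_ideal L (rmul_of L (1 - j)).
  apply/left_idealP; split; last exact: lsubmodule_rmul.
  by move=> _ [l Ll ->]; apply: LM => //; apply: subgroupB.
have [|M maxM IM] := left_ideal_in_max iI.
  by case=> l Ll E; apply: noinv; exists l.
apply: (max_left_ideal_proper maxM); have [gM _] := max_left_ideal_lsubmodule maxM.
apply: (subgroupBl gM (y := j)); last exact: Mj.
by apply: IM; exists 1; rewrite ?mul1r.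
Qed.

Lemma jrad_uniformizer : jrad L (iota p).
Proof.
have Lp := order_uniformizer; split=> // M maxM; apply: NNPP => nMp.
have [gM _] := max_left_ideal_lsubmodule maxM; have [iM _ _] := maxM.
have [l Ll Mlp] := max_left_ideal_inv sL maxM Lp nMp.
apply/(max_left_ideal_proper maxM)/(left_ideal_uniformizer_nakayama iM).
exists (1 - l * iota p); first by rewrite -opprB; apply: subgroupN.
by exists l; rewrite ?subKr.
Qed.

Lemma order_clear_denominator x : exists t, L (iota (p ^+ t) * x).
Proof.
case: oL => _ LR _ LK; have [r [_ r0 Lrx]] := LK x.
have [t Rt] := uniformizer_clear_denominator sR pR r^-1.
by exists t; rewrite -(iota_invK x r0) [iota _ * (_ * _)]mulrA -rmorphM; apply: LR.
Qed.

Lemma order_clear_denominators (I : finType) (s : I -> B) (M : B -> Prop) :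
  (forall x, M x -> exists2 c, forall i, R (c i) & x = \sum_i iota (c i) * s i) ->
  exists t, forall x, M x -> L (iota (p ^+ t) * x).
Proof.
move=> sP; have [_ LR _ _] := oL.
have [t tP] := fin_all_exists (fun i => order_clear_denominator (s i)).
exists (\sum_i t i)%N => x /sP [c Rc ->]; rewrite mulr_sumr.
apply: (subgroup_sum gL) => i _; rewrite mulrA [iota _ * _]iotaC -mulrA.
apply: (LR) => //; rewrite (bigD1 i) //= addnC exprD rmorphM -mulrA.
by apply: LR => //; apply: subringX => //; case: pR.
Qed.

Lemma order_lregular x :
  (forall l, L l -> x * l = 0 -> l = 0) -> forall y, x * y = 0 -> y = 0.
Proof.
move=> reg y xy0; case: oL => _ _ _ LK; have [r [_ r0 Lry]] := LK y.
rewrite -(iota_invK y r0); rewrite [iota r * y]reg ?mulr0 //.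
by rewrite mulrA -iotaC -mulrA xy0 mulr0.
Qed.

End Jacobson.

(* The lowest coefficient of a polynomial relation satisfied by [x] is cancelled
   down to the constant term, which exhibits a two-sided inverse. *)
Lemma lregular_invertible m (x : B) :
  dim_le m -> (forall y, x * y = 0 -> y = 0) -> exists y, x * y = 1 /\ y * x = 1.
Proof.
move=> dim_m reg; have [a [k0 k0m ak0] a0] := dim_m (fun k => x ^+ k).
elim: m.+1 a k0 k0m ak0 a0 => // n IHn a k0 k0n ak0; rewrite big_ord_recl /= expr0 mulr1.
pose q := \sum_(i < n) iota (a i.+1) * x ^+ i.
have -> : \sum_(i < n) iota (a (bump 0 i)) * x ^+ bump 0 i = x * q.
  by rewrite mulr_sumr; apply: eq_bigr => i _; rewrite mulrA -iotaC -mulrA -exprS.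
have qx : q * x = x * q.
  rewrite mulr_suml mulr_sumr; apply: eq_bigr => i _.
  by rewrite mulrA -iotaC -!mulrA -exprSr exprS.
case: (eqVneq (a 0%N) 0) => [a0|a0].
  rewrite a0 rmorph0 add0r => /reg q0; case: k0 k0n ak0 => [|k0] k0n ak0.
    by rewrite a0 eqxx in ak0.
  exact: (IHn (fun k => a k.+1) k0).
move/eqP; rewrite addrC addr_eq0 => /eqP xqE; exists (- (iota (a 0%N)^-1 * q)).
have a1 : iota (a 0%N)^-1 * iota (a 0%N) = 1 by rewrite -rmorphM mulVf // rmorph1.
have {}xqE : iota (a 0%N)^-1 * (x * q) = - 1 by rewrite xqE mulrN a1.
by split; [rewrite mulrN mulrA -iotaC -mulrA | rewrite mulNr -mulrA qx]; rewrite xqE opprK.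
Qed.

Lemma normal_order_generator L : central_order L -> normal_order L ->
  exists x y, [/\ jrad L x, x * y = 1, y * x = 1 & forall j, jrad L j <-> lmul_of x L j].
Proof.
move=> oL [_ [x [Jx [radL reg_x]]]]; have [m dim_m] := order_dim_le oL.
have [y [xy yx]] := lregular_invertible dim_m (order_lregular oL reg_x).
exists x, y; split=> // j; rewrite radL.
by split=> [[l [Ll ->]]|[l Ll ->]]; exists l.
Qed.

End Order.

(** * Dual bases of projective left ideals *)

Section DualBasis.
Variables (B : pzRingType) (L : B -> Prop).
Hypothesis sL : subring_of L.

Lemma linear_on_free m (q : ('I_m -> B) -> B) (v : 'I_m -> B) :
  (forall u u', (forall i, L (u i)) -> (forall i, L (u' i)) ->
     q (fun i => u i + u' i) = q u + q u') ->
  (forall l u, L l -> (forall i, L (u i)) -> q (fun i => l * u i) = l * q u) ->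
  (forall i, L (v i)) -> q v = \sum_k v k * q (fun j => (j == k)%:R).
Proof.
move=> qD qZ Lv; have [gL LM] := subring_lsubmodule sL; have L0 := subgroup0 gL.
pose e (k j : 'I_m) : B := (j == k)%:R.
have Le k j : L (e k j) by apply: subring_nat.
have q0 : q (fun=> 0) = 0.
  have L0' i : L ((fun=> 0 : B) i) by [].
  rewrite -[RHS](mul0r (q (fun=> 0))) -qZ //; congr q.
  by apply: functional_extensionality => j; rewrite mul0r.
suff sumE (r : seq 'I_m) :
    q (fun j => \sum_(k <- r) v k * e k j) = \sum_(k <- r) v k * q (e k).
  rewrite -sumE; congr q; apply: functional_extensionality => j.
  rewrite (bigD1 j) //= /e eqxx mulr1 big1 ?addr0 // => k kj.
  by rewrite eq_sym (negPf kj) mulr0.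
elim: r => [|k r IHr].
  rewrite big_nil -[RHS]q0; congr q.
  by apply: functional_extensionality => j; rewrite big_nil.
rewrite big_cons -IHr -qZ // -qD => [||j].
- by congr q; apply: functional_extensionality => j; rewrite big_cons.
- by move=> j; apply: LM.
- by apply: (subgroup_sum gL) => k' _; apply: LM.
Qed.

(* A splitting [s] of the projection [L^m -> I] is right multiplication by
   [z^-1 * s z], as [z * s v = s (z * v) = s (v * z) = v * s z]. *)
Lemma proj_left_dual_basis I z zV :
  left_ideal L I -> proj_left L I -> I z -> (forall b, z * b = b * z) -> zV * z = 1 ->
  exists m (w l : 'I_m -> B),
    [/\ forall k v, I v -> L (v * w k), forall k, I (l k) & \sum_k w k * l k = 1].
Proof.
move=> [IL _ _ _] [m [q [s [qI [qD [qZ [sL' [_ [sZ qs]]]]]]]]] Iz zC zVz.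
pose e (k j : 'I_m) : B := (j == k)%:R.
exists m, (fun k => zV * s z k), (fun k => q (e k)); split.
- move=> k v Iv; suff -> : v * (zV * s z k) = s v k by apply: sL'.
  have zsv : z * s v k = v * s z k by rewrite -sZ ?zC ?sZ //; apply: IL.
  have zVC : v * zV = zV * v.
    by rewrite -[LHS]mul1r -{1}zVz -mulrA [z * _]mulrA zC -!mulrA zC zVz mulr1.
  by rewrite mulrA zVC -mulrA -zsv mulrA zVz mul1r.
- by move=> k; apply: qI => j; apply: subring_nat.
- rewrite -zVz -{2}(qs z Iz) (linear_on_free qD qZ) => [|k]; last exact: sL'.
  by rewrite mulr_sumr; apply: eq_bigr => k _; rewrite mulrA.
Qed.

End DualBasis.

(** * The radical chain of a normal hereditary order *)

Definition largest_proper_ideal (B : pzRingType) (G P : B -> Prop) :=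
  [/\ ideal_of G P, ~ P 1 &
      forall I, ideal_of G I -> ~ I 1 -> forall a, I a -> P a].

Section RadicalChain.
Variables (K : fieldType) (R : K -> Prop) (p : K) (B : pzRingType).
Variables (iota : {rmorphism K -> B}) (L G P : B -> Prop) (x xV : B).
Hypotheses (sR : subring_of R) (pR : uniformizer R p).
Hypothesis iotaC : forall k b, iota k * b = b * iota k.
Hypothesis oL : central_order R iota L.
Hypotheses (sG : subring_of G) (LG : forall l, L l -> G l).
Hypothesis denominatorsG : exists t, forall g, G g -> L (iota (p ^+ t) * g).
Hypotheses (maxP : largest_proper_ideal G P) (qP : left_quasiregular G P).
Hypothesis Pp : P (iota p).
Hypotheses (xxV : x * xV = 1) (xVx : xV * x = 1).
Hypothesis radL : forall j, jrad L j <-> lmul_of x L j.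
Hypothesis herL : forall I, left_ideal L I -> proj_left L I.

Let sL : subring_of L. Proof. by case: oL. Qed.
Let L1 : L 1. Proof. by case: sL. Qed.
Let LM : lstable L L. Proof. by case: sL. Qed.
Let mL : lsubmodule L L := subring_lsubmodule sL.
Let gL : subgroup_of L := subring_subgroup sL.
Let G1 : G 1. Proof. by case: sG. Qed.
Let GM : lstable G G. Proof. by case: sG. Qed.
Let gG : subgroup_of G := subring_subgroup sG.
Let iP : ideal_of G P. Proof. by case: maxP. Qed.
Let gP : subgroup_of P. Proof. by case: iP. Qed.
Let lP : lstable G P. Proof. by case: iP. Qed.
Let nP1 : ~ P 1. Proof. by case: maxP. Qed.
Let p0 : p != 0. Proof. by case: pR. Qed.
Let mJ : lsubmodule L (jrad L) := jrad_lsubmodule sL.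
Let lJ : lstable L (jrad L). Proof. by case: mJ. Qed.
Let JxL l : L l -> jrad L (x * l). Proof. by move=> Ll; apply/radL; exists l. Qed.
Let Jx : jrad L x. Proof. by rewrite -[x]mulr1; apply: JxL. Qed.
Let Lx : L x. Proof. by case: Jx. Qed.

Definition chain (i : nat) := lmul_of (x ^+ i) G.

Lemma chain_subgroup i : subgroup_of (chain i).
Proof. exact: lmul_subgroup. Qed.

Lemma chain_rstable i : rstable G (chain i).
Proof. by apply: lmul_rstable => a g Ga Gg; apply: GM. Qed.

Lemma chain0 v : chain 0 v <-> G v.
Proof.
split=> [[g Gg ->]|Gv]; first by rewrite expr0 mul1r.
by exists v; rewrite // expr0 mul1r.
Qed.

Lemma chain_pow i : chain i (x ^+ i).
Proof. by exists 1; rewrite ?mulr1. Qed.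

Lemma chainS_mull i v : chain i v -> chain i.+1 (x * v).
Proof. by case=> g Gg ->; exists g; rewrite // exprS mulrA. Qed.

Lemma chainS_divl i v : chain i.+1 v -> exists2 u, chain i u & v = x * u.
Proof. by case=> g Gg ->; exists (x ^+ i * g); [exists g | rewrite exprS mulrA]. Qed.

Lemma chain_lstable i : lstable L (chain i).
Proof.
elim: i => [|i IHi] l v Ll; first by move/chain0 => Gv; apply/chain0/GM/Gv/LG.
case/chainS_divl=> u iu ->; have /radL [l' Ll' E] := lJ Ll Jx.
by rewrite mulrA E -mulrA; apply/chainS_mull/IHi.
Qed.

Lemma chain_lsubmodule i : lsubmodule L (chain i).
Proof. by split; [apply: chain_subgroup | apply: chain_lstable]. Qed.

Lemma chain_jrad i j v : jrad L j -> chain i v -> chain i.+1 (j * v).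
Proof. by case/radL=> l Ll -> iv; rewrite -mulrA; apply/chainS_mull/chain_lstable. Qed.

Lemma chainW i v : chain i.+1 v -> chain i v.
Proof. by case/chainS_divl=> u iu ->; apply: chain_lstable. Qed.

Lemma chain_le i j v : (i <= j)%N -> chain j v -> chain i v.
Proof.
by move=> /subnK <-; elim: (j - i)%N => [//|d IHd]; rewrite addSn => /chainW /IHd.
Qed.

Lemma chain_right_order i a : chain i (x ^+ i * a) -> G a.
Proof.
by case=> g Gg /(congr1 ( *%R (xV ^+ i))); rewrite !mulrA exprVK // !mul1r => ->.
Qed.

Lemma uniformizer_inv_notin : ~ G (iota p^-1).
Proof. by move=> Gp; apply: nP1; rewrite -(iota_invK iota 1 p0) mulr1; apply: lP. Qed.

Lemma jrad_nilpotent : exists N, exists2 l, L l & x ^+ N = iota p * l.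
Proof.
have [m dim_m] := order_dim_le oL; have [_ LR _ _] := oL.
have Lp := order_uniformizer pR oL.
have gpL : subgroup_of (lmul_of (iota p) L) by apply: lmul_subgroup.
have gxL k : subgroup_of (lmul_of (x ^+ k) L) by apply: lmul_subgroup.
pose I k := sum_of (lmul_of (x ^+ k) L) (lmul_of (iota p) L).
have scalars_lmul a : lstable (scalars R iota) (lmul_of a L).
  move=> _ _ [r Rr ->] [l Ll ->].
  by exists (iota r * l); [apply: LR | rewrite !mulrA iotaC].
have subI k : sublattice R p iota L (I k).
  split; first by apply: lsubmodule_sum; split=> //; apply: scalars_lmul.
  - move=> v [_ [a La ->] [b Lb E]]; apply: (subgroupBl gL (y := x ^+ k * a)).
      by rewrite E; apply: LM.
    by apply: LM => //; apply: subringX.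
  - by move=> v Lv; apply: (sum_ofr (gxL k)); exists v.
have [k nIk] := not_all_ex_not _ _ (no_long_sublattice_chain sR pR dim_m subI).
have [_ {}nIk] := imply_to_and _ _ nIk.
have Idecr v : I k.+1 v -> I k v.
  case=> _ [a La ->] pv; exists (x ^+ k.+1 * a) => //.
  by exists (x * a); [apply: LM | rewrite exprSr mulrA].
have Ik : I k (x ^+ k) by apply: (sum_ofl gpL); exists 1; rewrite ?mulr1.
have [_ [a La ->] [b Lb E]] := not_strict_sub nIk Idecr Ik; exists k.
have [s Ls [_ s1]] := quasiregular_inv mJ (jrad_quasiregular sR pR iotaC oL) (JxL La).
exists (b * s); first exact: LM.
rewrite mulrA -E exprSr -[x ^+ k * x * a]mulrA -[X in X - _]mulr1 -mulrBr -mulrA.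
by rewrite s1 mulr1.
Qed.

Lemma chain_uniformizer_dvd s :
  exists N, forall v, chain N v -> exists2 g, G g & v = iota (p ^+ s) * g.
Proof.
have [N [l Ll E]] := jrad_nilpotent; exists (N * s)%N => _ [g Gg ->].
exists (l ^+ s * g); first by apply: GM => //; apply: LG; apply: subringX.
by rewrite exprM E exprMn_comm ?mulrA ?rmorphXn //; apply: iotaC.
Qed.

Lemma chain_strict i : ~ chain i.+1 (x ^+ i).
Proof.
rewrite -[x ^+ i]mulr1 => -[g Gg /(congr1 ( *%R (xV ^+ i)))].
rewrite exprSr -mulrA !mulrA exprVK // !mul1r => xg.
have GxV : G xV by rewrite -[xV]mulr1 xg mulrA xVx mul1r.
have [N [l Ll E]] := jrad_nilpotent; apply: uniformizer_inv_notin.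
rewrite -[iota _]mulr1 -(exprVK N xxV) E -mulrA iota_invK //.
by apply: GM; [apply: LG | apply: subringX].
Qed.

Definition chain_dual (i : nat) (w : B) := forall v, chain i v -> L (v * w).

Lemma chain_dual_mulr i w l : chain_dual i w -> L l -> chain_dual i (w * l).
Proof. by move=> dw Ll v iv; rewrite mulrA; apply: LM => //; apply: dw. Qed.

Lemma chainS_dual_jrad i v w : chain i.+1 v -> chain_dual i w -> jrad L (v * w).
Proof. by case/chainS_divl=> u iu -> dw; rewrite -mulrA; apply/JxL/dw. Qed.

Lemma chain_dual_basis i : exists m (w l : 'I_m -> B),
  [/\ forall k, chain_dual i (w k), forall k, chain i (l k) & \sum_k w k * l k = 1].
Proof.
have [t tP] := denominatorsG; have [b bP] := order_clear_denominator sR pR oL (xV ^+ i).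
pose I := rmul_of (chain i) (iota (p ^+ t)); pose z := p ^+ b * p ^+ t.
have iI : left_ideal L I.
  apply/left_idealP; split; last exact/lsubmodule_rmul/chain_lsubmodule.
  by move=> _ [u iu ->]; rewrite -iotaC; apply/tP/chain0/(chain_le (leq0n i)).
have Iz : I (iota z).
  exists (iota (p ^+ b)); last by rewrite rmorphM.
  exists (xV ^+ i * iota (p ^+ b)); last by rewrite mulrA exprVK // mul1r.
  by rewrite -iotaC; apply: LG.
have zVz : iota z^-1 * iota z = 1.
  by rewrite -[iota z]mulr1 iota_invK // mulf_neq0 // expf_neq0.
have [m [w [l [wP Il wl]]]] :=
  proj_left_dual_basis sL iI (herL iI) Iz (iotaC z) zVz.
have [u iu lE] := fin_all_exists2 Il.
exists m, (fun k => iota (p ^+ t) * w k), u; split=> [k v iv||].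
- by rewrite mulrA; apply: wP; exists v.
- exact: iu.
- by rewrite -[RHS]wl; apply: eq_bigr => k _; rewrite lE mulrA -iotaC mulrA.
Qed.

Lemma chain_dual_detect i v : chain i v -> ~ chain i.+1 v ->
  exists w M, [/\ chain_dual i w, max_left_ideal L M & ~ M (v * w)].
Proof.
move=> iv niv; have [m [w [l [dw il wl]]]] := chain_dual_basis i.
have [k nJ] : exists k, ~ jrad L (v * w k).
  apply: not_all_ex_not => allJ; apply: niv.
  rewrite -[v]mulr1 -wl mulr_sumr; apply: (subgroup_sum (chain_subgroup _)) => k _.
  by rewrite mulrA; apply: chain_jrad.
have [M maxM nM] := not_jrad (dw k v iv) nJ.
by exists (w k), M; split.
Qed.

Lemma chain_lift i N U c : lsubmodule L N -> lsubmodule L U ->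
  (forall v, chain i v -> exists2 n, N n & U (v - n * c)) ->
  exists a, forall v, chain i v -> N (v * a) /\ U (v - v * a * c).
Proof.
move=> [gN lN] [gU lU] cov; have [m [w [l [dw il wl]]]] := chain_dual_basis i.
have [n Nn Un] := fin_all_exists2 (fun k => cov _ (il k)).
exists (\sum_k w k * n k) => v iv; split.
  rewrite mulr_sumr; apply: (subgroup_sum gN) => k _.
  by rewrite mulrA; apply: lN => //; apply: dw.
have -> : v - v * (\sum_k w k * n k) * c = \sum_k v * w k * (l k - n k * c).
  rewrite -{1}[v]mulr1 -wl -mulrA -mulrBr mulr_suml -sumrB mulr_sumr.
  by apply: eq_bigr => k _; rewrite -!mulrA -mulrBr.
by apply: (subgroup_sum gU) => k _; apply: lU => //; apply: dw.
Qed.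

Lemma chain_nakayama i N : lsubmodule L N ->
  (forall v, chain i v -> sum_of N (chain i.+1) v) -> forall v, chain i v -> N v.
Proof.
move=> [gN lN] cov v iv; have [m [w [l [dw il wl]]]] := chain_dual_basis i.
have expand u : u = \sum_k u * w k * l k.
  by rewrite -[LHS]mulr1 -wl mulr_sumr; apply: eq_bigr => k _; rewrite mulrA.
have JL j : jrad L j -> L j by case.
have Nl : forall k, N (l k).
  apply: (nakayama (V := B^o) sL JL mJ (jrad_quasiregular sR pR iotaC oL)) => // k.
  have [n Nn /chainS_divl [u iu E]] := cov _ (il k); exists n => //.
  exists (fun j => x * (u * w j)); first by move=> j; apply/JxL/dw.
  by rewrite E {1}[u]expand mulr_sumr; apply: eq_bigr => j _; rewrite !mulrA.
by rewrite [v]expand; apply: (subgroup_sum gN) => k _; apply: lN => //; apply: dw.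
Qed.

(** * The layers of the chain *)

Definition layer_submodule i N := [/\ lsubmodule L N,
  forall v, chain i.+1 v -> N v & forall v, N v -> chain i v].

Definition layer_complement i N U := [/\ layer_submodule i U,
  forall v, chain i v -> sum_of N U v & forall v, N v -> U v -> chain i.+1 v].

Lemma chain_layer i : layer_submodule i (chain i).
Proof. by split=> //; [apply: chain_lsubmodule | apply: chainW]. Qed.

Lemma layer_cap i N U :
  layer_submodule i N -> layer_submodule i U -> layer_submodule i (fun v => N v /\ U v).
Proof.
move=> [mN chainN Nchain] [mU chainU _]; split; first exact: lsubmodule_cap.
  by move=> v iv; split; [apply: chainN | apply: chainU].
by move=> v [/Nchain].
Qed.

Lemma layer_sum_chainS i N : lsubmodule L N -> (forall v, N v -> chain i v) ->
  layer_submodule i (sum_of N (chain i.+1)).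
Proof.
move=> mN Nchain; have [gN _] := mN; split.
- by apply: lsubmodule_sum => //; apply: chain_lsubmodule.
- exact: (sum_ofr gN).
- by move=> v [n /Nchain iin /chainW ivn]; apply: (subgroupBl (chain_subgroup i) ivn).
Qed.

Lemma layer_dual_kernel i w M : chain_dual i w -> max_left_ideal L M ->
  layer_submodule i (fun v => chain i v /\ M (v * w)).
Proof.
move=> dw maxM; split=> [|v iv|v [] //].
- apply: lsubmodule_cap; first exact: chain_lsubmodule.
  exact/lsubmodule_preim_mulr/max_left_ideal_lsubmodule.
- by split; [apply: chainW | have [_] := chainS_dual_jrad iv dw; apply].
Qed.

(* A minimal [U] with [N + U = chain i] works: an element of [N] and [U] outside
   [chain i.+1] would be detected by a maximal left ideal and let [U] shrink. *)
Lemma layer_complement_exists i N : layer_submodule i N -> exists U, layer_complement i N U.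
Proof.
move=> [[gN lN] _ Nchain]; have [m dim_m] := order_dim_le oL.
pose Q U := layer_submodule i U /\ forall v, chain i v -> sum_of N U v.
have QX U : Q U -> sublattice R p iota (chain i) U.
  move=> [[mU chainU Uchain] _]; split=> //; first exact: (lsubmodule_scalars oL).
  move=> v iv; apply/chainU/chain_jrad => //.
  exact: (jrad_uniformizer sR pR iotaC oL).
have Qchain : Q (chain i) by split; [apply: chain_layer | move=> v; apply: sum_ofr].
have [U [layU cov] minU] := minimal_sublattice sR pR dim_m QX Qchain.
have [[gU lU] chainU Uchain] := layU.
exists U; split=> // y Ny Uy; apply: NNPP => niy; have iy := Nchain y Ny.
have [w [M [dw maxM nM]]] := chain_dual_detect iy niy.
have [gM lM] := max_left_ideal_lsubmodule maxM.
have [s Ls sM] := max_left_ideal_inv sL maxM (dw _ iy) nM.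
pose U' v := U v /\ chain i v /\ M (v * w).
suff QU' : Q U' by apply: nM; case: (minU U' QU' (fun _ => @proj1 _ _) y Uy) => _ [].
split; first exact/layer_cap/layer_dual_kernel.
move=> v /cov [n Nn Uvn]; set u := v - n in Uvn.
have iu := Uchain u Uvn; have Luws : L (u * w * s) by apply: LM => //; apply: dw.
exists (n + u * w * s * y); first by apply: (subgroupD gN) => //; apply: lN.
rewrite opprD addrA -/u; split; first by apply: (subgroupB gU) => //; apply: lU.
split; first by apply: (subgroupB (chain_subgroup i)) => //; apply: chain_lstable.
have -> : (u - u * w * s * y) * w = - (u * w * (s * (y * w) - 1)).
  by rewrite mulrBl mulrBr opprB mulr1 !mulrA.
by apply: (subgroupN gM); apply: lM => //; apply: dw.
Qed.

Definition transporter i N g := G g /\ forall v, chain i v -> N (v * g).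

Lemma transporter_ideal i N : subgroup_of N -> rstable G N -> ideal_of G (transporter i N).
Proof.
move=> gN rN; split.
- by move=> g [].
- split; first by split=> [|v _]; [apply: (subgroup0 gG) | rewrite mulr0; apply: subgroup0].
  move=> g h [Gg Ng] [Gh Nh]; split=> [|v iv]; first exact: (subgroupB gG).
  by rewrite mulrBr; apply: (subgroupB gN); [apply: Ng | apply: Nh].
- move=> a g Ga [Gg Ng]; split=> [|v iv]; first exact: GM.
  by rewrite mulrA; apply/Ng/chain_rstable.
- move=> a g Ga [Gg Ng]; split=> [|v iv]; first exact: GM.
  by rewrite mulrA; apply/rN/Ng.
Qed.

Lemma transporter_sub i N a : subgroup_of N -> rstable G N ->
  transporter i N a -> ~ P a -> forall v, chain i v -> N v.
Proof.
move=> gN rN Na nPa v iv; have [_ _ largestP] := maxP.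
suff [_ N1] : transporter i N 1 by rewrite -[v]mulr1; apply: N1.
apply: NNPP => nN1; apply: nPa; apply: largestP Na => //.
exact: transporter_ideal.
Qed.

(* A right multiplication [a] lifts the projection of the layer onto [N]. *)
Lemma layer_simple i N : layer_submodule i N -> rstable G N ->
  ~ (forall v, N v -> chain i.+1 v) -> forall v, chain i v -> N v.
Proof.
move=> layN rN nN; have [[gN lN] _ Nchain] := layN.
have [U [[[gU lU] _ _] cov capU]] := layer_complement_exists layN.
have [v iv|a aP] := @chain_lift i N U 1 (conj gN lN) (conj gU lU).
  by have [n Nn Un] := cov v iv; exists n; rewrite ?mulr1.
have Ga : G a.
  by apply: (@chain_right_order i); apply: Nchain; case: (aP _ (chain_pow i)).
apply: (@transporter_sub i N a gN rN) => [|Pa].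
  by split=> // v iv; case: (aP v iv).
apply: nN => v Nv; apply: capU => //.
have [g Gg ga1] := qP Pa.
have [_] := aP (v * g) (chain_rstable Gg (Nchain v Nv)).
by rewrite mulr1 -mulrA -mulrBr -[X in _ * (X - _)]mulr1 -mulrBr ga1 mulr1.
Qed.

Lemma radical_chain_step i : (forall a, P a -> chain i a) ->
  (forall a, P a -> chain i.+1 a) \/ (forall a, chain i a -> P a).
Proof.
move=> Pi; have mP : lsubmodule L P by apply: (lsubmoduleW LG).
pose N := sum_of P (chain i.+1).
have rN : rstable G N by apply: rstable_sum (@chain_rstable _); case: iP.
case: (classic (forall v, N v -> chain i.+1 v)) => [Nchain|nN].
  by left=> a Pa; apply: Nchain; apply: (sum_ofl (chain_subgroup _)).
by right; apply: chain_nakayama => // v; apply: layer_simple => //; apply: layer_sum_chainS.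
Qed.

Lemma radical_eq_chain : exists2 e, (0 < e)%N & forall a, P a <-> chain e a.
Proof.
apply: NNPP => noe; have Pchain k a : P a -> chain k a.
  elim: k a => [|k IHk] a Pa; first by case: iP => PG _ _ _; apply/chain0/PG.
  case: (radical_chain_step IHk) => [|chainP]; first exact.
  case: k IHk chainP => [|k] IHk chainP; first by case: nP1; apply/chainP/chain0.
  by case: noe; exists k.+1 => // b; split; [apply: IHk | apply: chainP].
have [N NP] := chain_uniformizer_dvd 2; apply: uniformizer_inv_notin.
have [g Gg E] := NP _ (Pchain N _ Pp).
rewrite (_ : iota p^-1 = g) // -[RHS](iota_invK iota _ (expf_neq0 2 p0)) -E -rmorphM.
by rewrite expr2 invfM mulfVK.
Qed.

(* Von Neumann regularity of the semisimple bimodule [chain i / chain i.+1]. *)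
Lemma layer_regular i y : chain i y ->
  exists2 w, chain_dual i w & chain i.+1 (y - y * w * y).
Proof.
move=> iy; have mLy : lsubmodule L (rmul_of L y) by apply: lsubmodule_rmul.
have Ly_chain v : rmul_of L y v -> chain i v by case=> l Ll ->; apply: chain_lstable.
pose N := sum_of (rmul_of L y) (chain i.+1).
have layN : layer_submodule i N by apply: layer_sum_chainS.
have [U [[mU chainU _] cov capU]] := layer_complement_exists layN.
have [[gU _] [[gN lN] _ _]] := (mU, layN).
have Ny : N y by apply: (sum_ofl (chain_subgroup _)); exists 1; rewrite ?mul1r.
have [v iv|w wP] := @chain_lift i L U y mL mU.
  have [n [_ [l Ll ->] /chainU Un] Uvn] := cov v iv; exists l => //.
  by rewrite -(subrKA n); apply: (subgroupD gU).
exists w => [v iv|]; first by case: (wP v iv).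
have [Lyw Uyw] := wP y iy; apply: capU => //.
by apply: (subgroupB gN) => //; apply: lN.
Qed.

(** * Simple modules as quotients of the layers *)

(* The simple module [L / M] is a quotient of [chain i]. *)
Definition has_quotient i (M : B -> Prop) :=
  exists v w, [/\ chain i v, chain_dual i w & ~ M (v * w)].

Lemma has_quotient_section i M : max_left_ideal L M -> has_quotient i M ->
  exists z w, [/\ chain i z, chain_dual i w & M (z * w - 1)].
Proof.
move=> maxM [v [w [iv dw nM]]].
have [l Ll lM] := max_left_ideal_inv sL maxM (dw _ iv) nM.
by exists (l * v), w; rewrite -mulrA; split=> //; apply: chain_lstable.
Qed.

Lemma has_quotient_exists M : max_left_ideal L M -> exists i, has_quotient i M.
Proof.
move=> maxM; have [gM lM] := max_left_ideal_lsubmodule maxM.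
have [i [v [iv Lv nMv]] Mi] : exists2 i, exists v, [/\ chain i v, L v & ~ M v] &
    forall v, chain i.+1 v -> L v -> M v.
  apply: NNPP => noi; have all_i k : exists v, [/\ chain k v, L v & ~ M v].
    elim: k => [|k IHk].
      by exists 1; split; [apply/chain0 | | apply: max_left_ideal_proper maxM].
    apply: NNPP => nk; apply: noi; exists k => // v kv Lv; apply: NNPP => nMv.
    by apply: nk; exists v.
  have [t tP] := denominatorsG; have [N NP] := chain_uniformizer_dvd t.+1.
  have [v [Nv Lv nMv]] := all_i N; have [g Gg vE] := NP v Nv; apply: nMv.
  rewrite vE exprSr rmorphM -mulrA (iotaC p g) mulrA.
  by apply: lM; [apply: tP | have [_] := jrad_uniformizer sR pR iotaC oL; apply].
have [w dw yw] := layer_regular iv; exists i, v, (w * v); split=> //.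
  exact: chain_dual_mulr.
move=> Mvwv; apply: nMv; apply: (subgroupBl gM (y := v * w * v)).
  by apply: Mi => //; apply: (subgroupB gL) => //; apply: LM => //; apply: dw.
by rewrite -mulrA.
Qed.

Lemma has_quotient_inhabited i : exists2 M, max_left_ideal L M & has_quotient i M.
Proof.
have [w [M [dw maxM nM]]] := chain_dual_detect (chain_pow i) (@chain_strict i).
by exists M => //; exists (x ^+ i), w; split=> //; apply: chain_pow.
Qed.

Lemma quot_iso_has_quotient i M M' :
  max_left_ideal L M' -> quot_iso L M M' -> has_quotient i M -> has_quotient i M'.
Proof.
move=> maxM' [f [fL [_ [fZ [fM _]]]]] [v [w [iv dw nM]]].
have [gM' _] := max_left_ideal_lsubmodule maxM'; have Lvw := dw v iv.
exists v, (w * f 1); split=> //; first by apply: chain_dual_mulr => //; apply: fL.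
rewrite mulrA => M'vw; apply: nM; apply/fM => //.
by apply: (subgroupBl gM') M'vw; rewrite -{1}[v * w]mulr1; apply: fZ.
Qed.

(* If no translate [v * g], [v] in [V], were seen by [w'], then by simplicity of
   the layer [w'] would not see any of it. *)
Lemma layer_translate_detected i V z M' w' : layer_submodule i V -> V z -> ~ chain i.+1 z ->
  max_left_ideal L M' -> chain_dual i w' -> (exists2 z', chain i z' & ~ M' (z' * w')) ->
  exists v g, [/\ V v, G g & ~ M' (v * g * w')].
Proof.
move=> [_ _ Vchain] Vz nz maxM' dw' [z' iz' nM'].
have [gM' lM'] := max_left_ideal_lsubmodule maxM'.
pose N v := chain i v /\ forall g, G g -> M' (v * g * w').
apply: NNPP => novg; have VN v : V v -> N v.
  move=> Vv; split=> [|g Gg]; first exact: Vchain.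
  by apply: NNPP => nM; apply: novg; exists v, g.
have layN : layer_submodule i N.
  split=> [|v iv|v []//].
    apply: lsubmodule_cap; first exact: chain_lsubmodule.
    split; first split=> [g _|u v Mu Mv g Gg]; first by rewrite !mul0r; apply: subgroup0.
      by rewrite !mulrBl; apply: (subgroupB gM'); [apply: Mu | apply: Mv].
    by move=> l v Ll Mv g Gg; rewrite -!mulrA; apply: lM' => //; rewrite mulrA; apply: Mv.
  split=> [|g Gg]; first exact: chainW.
  by have [_] := chainS_dual_jrad (chain_rstable Gg iv) dw'; apply.
have rN : rstable G N.
  move=> h v Gh [iv Mv]; split=> [|g Gg]; first exact: chain_rstable.
  by rewrite -[v * h * g]mulrA; apply/Mv/GM.
have nN : ~ forall v, N v -> chain i.+1 v by move=> Nchain; apply/nz/Nchain/VN.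
have [_ /(_ 1 G1)] := layer_simple layN rN nN iz'.
by rewrite mulr1; apply: nM'.
Qed.

(* A complement [V] of the kernel of [chain i -> L / M] is a copy of [L / M], and
   the translate of [V] seen by [M'] maps it isomorphically to [L / M']. *)
Lemma has_quotient_quot_iso i M M' : max_left_ideal L M -> max_left_ideal L M' ->
  has_quotient i M -> has_quotient i M' -> quot_iso L M M'.
Proof.
move=> maxM maxM' qM qM'.
have [gM lM] := max_left_ideal_lsubmodule maxM.
have [gM' lM'] := max_left_ideal_lsubmodule maxM'.
have [z0 [w [iz0 dw z0w]]] := has_quotient_section maxM qM.
have [z' [w' [iz' dw' nM']]] := qM'.
have [V [layV cov capV]] := layer_complement_exists (layer_dual_kernel dw maxM).
have [[gV lV] _ Vchain] := layV.
have [z Vz zw] : exists2 z, V z & M (z * w - 1).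
  have [u [_ Mu] Vz] := cov z0 iz0; exists (z0 - u) => //.
  by rewrite mulrBl addrAC; apply: (subgroupB gM).
have nz : ~ chain i.+1 z.
  move=> /chainS_dual_jrad /(_ dw) [_ Jzw]; apply: (max_left_ideal_proper maxM).
  exact: (subgroupBr gM zw (Jzw M maxM)).
have [|v [g [Vv Gg nMv]]] := layer_translate_detected layV Vz nz maxM' dw'.
  by exists z'.
have kernel_vanishes u : V u -> M (u * w) -> M' (u * g * w').
  move=> Vu Mu; have Su : chain i.+1 u by apply: capV => //; split=> //; apply: Vchain.
  by have [_] := chainS_dual_jrad (chain_rstable Gg Su) dw'; apply.
have Lzgw : L (z * g * w') by apply/dw'/chain_rstable/Vchain.
apply: (quot_iso_mulr sL maxM maxM' Lzgw) => [m Mm|M'zgw].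
  have Lm : L m by case: maxM => -[ML _ _ _] _ _; apply: ML.
  rewrite !mulrA; apply: kernel_vanishes; first exact: lV.
  rewrite -mulrA -[z * w](subrK 1) mulrDr mulr1.
  by apply: (subgroupD gM) => //; apply: lM.
have Lvw : L (v * w) by apply/dw/Vchain.
apply: nMv; apply: (subgroupBl gM' (y := v * w * (z * g * w'))); last exact: lM'.
rewrite !mulrA -!mulrBl; apply: kernel_vanishes.
  by apply: (subgroupB gV) => //; apply: lV.
have -> : (v - v * w * z) * w = - (v * w * (z * w - 1)).
  by rewrite mulrBl mulrBr opprB mulr1 !mulrA.
by apply: (subgroupN gM); apply: lM.
Qed.

Section Period.
Variable e : nat.
Hypotheses (e_gt0 : (0 < e)%N) (chain_e : forall a, P a <-> chain e a).

Lemma chain_addn i v : chain (i + e) v <-> lmul_of (x ^+ i) P v.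
Proof.
split=> [[g Gg ->]|[q /chain_e [g Gg ->] ->]].
  by exists (x ^+ e * g); [apply/chain_e; exists g | rewrite exprD mulrA].
by exists g; rewrite // exprD mulrA.
Qed.

Lemma chain_mulr_P i v q : chain i v -> P q -> chain (i + e) (v * q).
Proof.
by case=> g Gg -> Pq; apply/chain_addn; exists (g * q); rewrite ?mulrA //; apply: lP.
Qed.

Lemma has_quotient_subn i M : has_quotient (i + e) M -> has_quotient i M.
Proof.
case=> _ [w [/chain_addn [q Pq ->] dw nM]]; exists (x ^+ i), (q * w).
rewrite mulrA; split=> //; first exact: chain_pow.
by move=> v iv; rewrite mulrA; apply/dw/chain_mulr_P.
Qed.

Lemma has_quotient_lt M : max_left_ideal L M -> exists i : 'I_e, has_quotient i M.
Proof.
move=> maxM; have [i] := has_quotient_exists maxM; elim/ltn_ind: i => i IHi qi.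
case: (ltnP i e) => [ie|ei]; first by exists (Ordinal ie).
apply: (IHi (i - e)%N); first by rewrite ltn_subrL e_gt0 (leq_trans e_gt0).
by apply: has_quotient_subn; rewrite subnK.
Qed.

Lemma has_quotient_period_inj i j M : max_left_ideal L M -> (i < j < i + e)%N ->
  has_quotient i M -> ~ has_quotient j M.
Proof.
move=> maxM /andP [ij je] [v [w [iv dw nM]]] qj.
have [gM lM] := max_left_ideal_lsubmodule maxM.
have [z [w' [jz dw' zw']]] := has_quotient_section maxM qj.
have wz_chain u : chain i u -> chain j (u * (w * z)).
  by move=> iu; rewrite mulrA; apply: chain_lstable => //; apply: dw.
have Gwz : G (w * z).
  by apply: (@chain_right_order i); apply: (chain_le (ltnW ij)); apply/wz_chain/chain_pow.
case: (classic (P (w * z))) => [Pwz|nPwz].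
  apply: nM; have vwz := chain_le je (chain_mulr_P iv Pwz).
  have [_ /(_ M maxM) Mvwz] := chainS_dual_jrad vwz dw'.
  apply: (subgroupBr gM (x := v * (w * z) * w')) => //.
  rewrite !mulrA -[_ * z * w']mulrA -[X in _ - X]mulr1 -mulrBr.
  by apply: lM => //; apply: dw.
apply: (@chain_strict i); apply: (chain_le ij).
apply: (transporter_sub (chain_subgroup j) (@chain_rstable j) _ nPwz) (chain_pow i).
by split.
Qed.

Lemma num_simple_classes_period d : num_simple_classes L d -> d = e.
Proof.
case=> Ms [maxMs inj cov].
have [f fP] := fin_all_exists (fun k => has_quotient_lt (maxMs k)).
have f_inj : injective f.
  by move=> k k' E; apply/inj/(@has_quotient_quot_iso (f k)) => //; rewrite E.
have f_surj i : exists k, f k = i.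
  have [M maxM qM] := has_quotient_inhabited i; have [k iso] := cov M maxM; exists k.
  have qi := quot_iso_has_quotient (maxMs k) iso qM; apply: val_inj.
  have lte (a b : 'I_e) : (a < b)%N -> (a < b < a + e)%N.
    by move=> ->; apply: leq_trans (ltn_ord b) (leq_addl _ _).
  case: (ltngtP (f k) i) => // /lte lt.
    by case: (has_quotient_period_inj (maxMs k) lt (fP k)).
  by case: (has_quotient_period_inj (maxMs k) lt qi).
apply/eqP; rewrite -[d]card_ord -[X in _ == X]card_ord -(card_codom f_inj).
by apply/eqP/eq_card => i; rewrite !inE; have [k <-] := f_surj i; apply: codom_f.
Qed.

Definition chain_stabilizer a :=
  forall i, (i < e)%N -> forall v, chain i v -> chain i (a * v).

Lemma chain_stabilizer_all a i v : chain_stabilizer a -> chain i v -> chain i (a * v).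
Proof.
move=> aP; elim/ltn_ind: i v => i IHi v; case: (ltnP i e) => [ie|ei]; first exact: aP.
rewrite -(subnK ei) => /chain_addn [q Pq ->]; rewrite mulrA.
apply: chain_mulr_P => //; apply: IHi; last exact: chain_pow.
by rewrite ltn_subrL e_gt0 (leq_trans e_gt0).
Qed.

(* The elements of [L] carrying the stabiliser into [L] form a left ideal, which
   contains all trace ideals [chain i * chain_dual i] and so is [L]. *)
Lemma chain_stabilizerP a : L a <-> chain_stabilizer a.
Proof.
split=> [La i _ v|aP]; first exact: chain_lstable.
pose T t := L t /\ forall b, chain_stabilizer b -> L (b * t).
have iT : left_ideal L T.
  split.
  - by move=> t [].
  - by split=> [|b _]; rewrite ?mulr0; apply: (subgroup0 gL).
  - move=> s t [Ls sP] [Lt tP]; split; first exact: (subgroupB gL).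
    by move=> b bP; rewrite mulrBr; apply: (subgroupB gL); [apply: sP | apply: tP].
  - move=> l t Ll [Lt tP]; split; first exact: LM.
    move=> b bP; rewrite mulrA; apply: tP => i ie v iv; rewrite -mulrA.
    by apply/(bP i ie)/chain_lstable.
case: (classic (T 1)) => [[_ T1]|nT1]; first by rewrite -[a]mulr1; apply: T1.
have [M maxM TM] := left_ideal_in_max sR pR iotaC oL iT nT1.
have [i [v [w [iv dw []]]]] := has_quotient_exists maxM; apply: TM.
split=> [|b bP]; first exact: dw.
by rewrite mulrA; apply/dw/chain_stabilizer_all.
Qed.

End Period.

Lemma radical_chain_structure d : num_simple_classes L d ->
  [/\ (0 < d)%N, forall a, P a <-> chain d a & forall a, L a <-> chain_stabilizer d a].
Proof.
move=> dL; have [e e_gt0 chain_e] := radical_eq_chain.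
rewrite (num_simple_classes_period e_gt0 chain_e dL); split=> // a.
exact: chain_stabilizerP.
Qed.

End RadicalChain.

(** * Matrices with entries in a subset of a ring *)

Definition mx_in (A : Type) (m n : nat) (Q : A -> Prop) (M : 'M[A]_(m, n)) :=
  forall i j, Q (M i j).

Section MatricesIn.
Variable A : pzRingType.
Implicit Types S Q P : A -> Prop.

Lemma mx_in_col Q m n (M : 'M[A]_(m, n)) : mx_in Q M <-> forall j, mx_in Q (col j M).
Proof. by split=> [MQ j i k|MQ i j]; [|have := MQ j i 0]; rewrite mxE. Qed.

Lemma mx_in_mxcol Q k (q : 'I_k -> nat) n (C : forall i, 'M[A]_(q i, n)) :
  mx_in Q (\mxcol_i C i) <-> forall i, mx_in Q (C i).
Proof.
split=> [CQ i a b|CQ i j]; last by rewrite mxE; apply: CQ.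
by rewrite -[C i](mxcolK C) mxE; apply: CQ.
Qed.

Lemma mx_in_subgroup Q m n : subgroup_of Q -> subgroup_of (@mx_in A m n Q).
Proof.
move=> gQ; split=> [i j|M N MQ NQ i j]; rewrite !mxE; first exact: subgroup0.
exact: subgroupB.
Qed.

Lemma mx_in_mull S Q m n k (M : 'M_(m, n)) (N : 'M_(n, k)) :
  subgroup_of Q -> lstable S Q -> mx_in S M -> mx_in Q N -> mx_in Q (M *m N).
Proof.
move=> gQ lQ MS NQ i j; rewrite mxE.
by apply: subgroup_sum => // l _; apply: lQ.
Qed.

Lemma mx_in_mulr S Q m n k (M : 'M_(m, n)) (N : 'M_(n, k)) :
  subgroup_of Q -> rstable S Q -> mx_in Q M -> mx_in S N -> mx_in Q (M *m N).
Proof.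
move=> gQ rQ MQ NS i j; rewrite mxE.
by apply: subgroup_sum => // l _; apply: rQ.
Qed.

Lemma mx_in_mul S m n k (M : 'M_(m, n)) (N : 'M_(n, k)) :
  subring_of S -> mx_in S M -> mx_in S N -> mx_in S (M *m N).
Proof. by move=> /subring_lsubmodule [gS SM]; apply: mx_in_mull. Qed.

Lemma mx_in_scalar Q n a : subgroup_of Q -> Q a -> mx_in Q (a%:M : 'M_n).
Proof. by move=> gQ Qa i j; rewrite mxE; case: eqP => _ //=; apply: subgroup0. Qed.

Lemma mx_over_subring S n : subring_of S -> subring_of (@mx_over A n S).
Proof.
move=> sS; have [gS lS] := subring_lsubmodule sS; have [_ gmS] := mx_in_subgroup n n gS.
split=> // [|M N]; last exact: mx_in_mull.
by apply: mx_in_scalar => //; case: sS.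
Qed.

Lemma mx_over_ideal S P n : ideal_of S P -> ideal_of (@mx_over A n S) (@mx_over A n P).
Proof.
move=> [PS gP lP rP]; split=> [M MP i j||M N|M N MS NP].
- exact: PS.
- exact: mx_in_subgroup.
- exact: mx_in_mull.
- exact: (mx_in_mulr gP rP).
Qed.

Lemma mx_quasiregular S Q n : subring_of S -> (forall q, Q q -> S q) -> lsubmodule S Q ->
  left_quasiregular S Q -> left_quasiregular (@mx_over A n S) (@mx_over A n Q).
Proof.
move=> sS QS mQ qQ a aQ; have gS := subring_subgroup sS; have [_ _ SM] := sS.
pose N (v : 'rV[A]_n) := exists2 u : 'rV_n, mx_in S u & v = u *m (1%:M - a).
have gN : subgroup_of N.
  split=> [|_ _ [u uS ->] [v vS ->]].
    by exists 0; [apply: (subgroup0 (mx_in_subgroup _ _ gS)) | rewrite mul0mx].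
  by exists (u - v); [apply: (subgroupB (mx_in_subgroup _ _ gS)) | rewrite mulmxBl].
have deltaS (k : 'I_n) : mx_in S (delta_mx 0 k : 'rV_n).
  by move=> i j; rewrite mxE; apply: subring_nat.
have /fin_all_exists2 [u uS uE] : forall k : 'I_n, N (delta_mx 0 k).
  apply: (nakayama sS QS mQ qQ gN) => [s _ Ss [u uS ->]|k].
    by exists (s *: u); [move=> i j; rewrite mxE; apply: SM | rewrite scalemxAl].
  exists (delta_mx 0 k *m (1%:M - a)); first by exists (delta_mx 0 k).
  exists (fun i => a k i) => //; rewrite mulmxBr mulmx1 subKr -rowE [LHS]row_sum_delta.
  by apply: eq_bigr => i _; rewrite mxE.
exists (\matrix_i u i); first by move=> i j; rewrite mxE; apply: uS.
by apply/row_matrixP => i; rewrite row_mul rowK -uE rowE mulmx1.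
Qed.

Lemma mx_invertible_mod S P n (M : 'M[A]_n) : subring_of S -> ideal_of S P ->
  left_quasiregular S P -> mx_in P (1%:M - M) ->
  exists2 M', mx_in S M' & M' *m M = 1%:M /\ M *m M' = 1%:M.
Proof.
move=> sS iP qP MP; have [PS gP lP _] := iP; have [_ gmP lmP _] := mx_over_ideal n iP.
have qmP := mx_quasiregular (n := n) sS PS (conj gP lP) qP.
have [M' M'S M'1] := quasiregular_inv (conj gmP lmP) qmP MP.
by exists M' => //; move: M'1; rewrite subKr.
Qed.

Lemma mulmx_col m n k (M : 'M[A]_(m, n)) (N : 'M[A]_(n, k)) j :
  col j (M *m N) = M *m col j N.
Proof. by rewrite !colE mulmxA. Qed.

Lemma mul_delta_mx_delta m n p q (M : 'M[A]_(n, p)) (a b : A)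
    (i : 'I_m) (k : 'I_n) (l : 'I_p) (j : 'I_q) :
  a *: delta_mx i k *m M *m (b *: delta_mx l j) = (a * M k l * b) *: delta_mx i j.
Proof.
apply/matrixP => s t; rewrite !mxE (bigD1 l) //= big1 => [|l' /negPf ll']; last first.
  by rewrite !mxE ll' !mulr0.
rewrite !mxE eqxx addr0 (bigD1 k) //= big1 => [|k' /negPf kk']; last first.
  by rewrite !mxE kk' andbF mulr0 mul0r.
rewrite !mxE eqxx addr0 andbT.
by case: (s == i); case: (t == j); rewrite ?mulr0 ?mul0r ?mulr1.
Qed.

Lemma mx_ideal_entry S n (I : 'M[A]_n -> Prop) M i j a b : subring_of S ->
  ideal_of (@mx_over A n S) I -> I M -> S a -> S b -> I (a * M i j * b)%:M.
Proof.
move=> sS [_ gI lI rI] IM Sa Sb; have [_ SM] := subring_lsubmodule sS.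
have Sdelta c k l : S c -> mx_over S (c *: delta_mx k l : 'M_n).
  by move=> Sc s t; rewrite !mxE; apply: SM => //; apply: subring_nat.
rewrite scalar_mx_sum_delta; apply: (subgroup_sum gI) => k _.
rewrite -mul_delta_mx_delta; apply: rI; first exact: Sdelta.
by apply: lI => //; apply: Sdelta.
Qed.

End MatricesIn.

(** * Block matrices *)

Section BlockMatrices.
Variable A : pzRingType.

Definition flatten_mx b n (Y : 'M['M[A]_n]_b) : 'M[A]_(\sum_(i < b) n) :=
  \mxblock_(i, j) Y i j.

Definition unflatten_mx b n (Z : 'M[A]_(\sum_(i < b) n)) : 'M['M[A]_n]_b :=
  \matrix_(i, j) submxblock Z i j.

Definition swap_levels c d (Y : 'M['M[A]_c]_d) : 'M['M[A]_d]_c :=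
  \matrix_(i, j) \matrix_(k, l) Y k l i j.

Lemma flatten_mxK b n : cancel (@flatten_mx b n) (@unflatten_mx b n).
Proof. by move=> Y; apply/matrixP => i j; rewrite mxE mxblockK. Qed.

Lemma unflatten_mxK b n : cancel (@unflatten_mx b n) (@flatten_mx b n).
Proof. by move=> Z; rewrite -[RHS]submxblockK; apply: eq_mxblock => i j; rewrite mxE. Qed.

Lemma flatten_mxD b n : {morph @flatten_mx b n : Y Z / Y + Z}.
Proof. by move=> Y Z; rewrite -mxblockD; apply: eq_mxblock => i j; rewrite mxE. Qed.

Lemma flatten_mxM b n : {morph @flatten_mx b n : Y Z / Y * Z}.
Proof. by move=> Y Z; rewrite [RHS]mul_mxblock; apply: eq_mxblock => i j; rewrite mxE. Qed.

Lemma flatten_mx1 b n : flatten_mx (1 : 'M['M[A]_n]_b) = 1.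
Proof.
by rewrite -[LHS]mulr1 -[X in _ * X]unflatten_mxK -flatten_mxM mul1r unflatten_mxK.
Qed.

Lemma unflatten_mxD b n : {morph @unflatten_mx b n : Y Z / Y + Z}.
Proof. by move=> Y Z; apply/matrixP => i j; rewrite !mxE submxblockD. Qed.

Lemma unflatten_mxM b n : {morph @unflatten_mx b n : Y Z / Y * Z}.
Proof.
move=> Y Z; apply: (can_inj (@flatten_mxK b n)).
by rewrite flatten_mxM !unflatten_mxK.
Qed.

Lemma swap_levelsK c d : cancel (@swap_levels c d) (@swap_levels d c).
Proof. by move=> Y; apply/matrixP => i j; apply/matrixP => k l; rewrite !mxE. Qed.

Lemma swap_levelsD c d : {morph @swap_levels c d : Y Z / Y + Z}.
Proof. by move=> Y Z; apply/matrixP => i j; apply/matrixP => k l; rewrite !mxE. Qed.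

Lemma swap_levelsM c d : {morph @swap_levels c d : Y Z / Y * Z}.
Proof.
move=> Y Z; apply/matrixP => i j; apply/matrixP => k l.
rewrite !mxE !summxE; under eq_bigr => q _ do rewrite mxE.
rewrite exchange_big; apply: eq_bigr => q _; rewrite mxE.
by apply: eq_bigr => s _; rewrite !mxE.
Qed.

Definition copies_mx b n (x : 'M[A]_n) := flatten_mx (x%:M : 'M['M[A]_n]_b).

Lemma copies_mxM b n (x y : 'M[A]_n) : copies_mx b x * copies_mx b y = copies_mx b (x * y).
Proof. by rewrite -flatten_mxM -mulmxE -scalar_mxM. Qed.

Lemma copies_mxX b n (x : 'M[A]_n) k : copies_mx b x ^+ k = copies_mx b (x ^+ k).
Proof.
elim: k => [|k IHk]; first by rewrite !expr0 -flatten_mx1.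
by rewrite !exprS IHk copies_mxM.
Qed.

Lemma copies_mx_mxcol b n k (x : 'M[A]_n) (v : 'I_b -> 'M[A]_(n, k)) :
  copies_mx b x *m (\mxcol_i v i) = \mxcol_i (x *m v i).
Proof.
rewrite mul_mxblock_mxrow; apply: eq_mxcol => i.
rewrite (bigD1 i) //= mxE eqxx big1 ?addr0 // => j ji.
by rewrite mxE eq_sym (negPf ji) mul0mx.
Qed.

Lemma mx_in_copies Q b n (x : 'M[A]_n) :
  subgroup_of Q -> mx_in Q x -> mx_in Q (copies_mx b x).
Proof.
move=> gQ xQ i j; rewrite mxE mxE; case: eqP => _ //=.
by rewrite mulr0n mxE; apply: subgroup0.
Qed.

End BlockMatrices.

Lemma bijective_ring_iso (B1 B2 : pzRingType) (f : B1 -> B2) (S1 : B1 -> Prop)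
    (S2 : B2 -> Prop) :
  bijective f -> {morph f : y z / y + z} -> {morph f : y z / y * z} ->
  (forall y, S1 y <-> S2 (f y)) -> ring_iso S1 S2.
Proof.
move=> [g fK gK] fD fM fS; exists f; do 5?split => //.
- by move=> y /fS.
- by move=> z Sz; exists (g z); rewrite gK; split=> //; apply/fS; rewrite gK.
- by move=> y z _ _; apply: (can_inj fK).
- by rewrite -[LHS]mulr1 -[X in _ * X]gK -fM mul1r gK.
Qed.

Lemma conj_ring_iso (A : pzRingType) b n c d (G : 'M[A]_(\sum_(i < b) n, \sum_(k < d) c))
    (H : 'M[A]_(\sum_(k < d) c, \sum_(i < b) n)) (S1 : 'M['M[A]_n]_b -> Prop)
    (S2 : 'M['M[A]_d]_c -> Prop) :
  G *m H = 1%:M -> H *m G = 1%:M ->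
  (forall Y, S1 Y <-> S2 (swap_levels (unflatten_mx (H *m flatten_mx Y *m G)))) ->
  ring_iso S1 S2.
Proof.
move=> GH HG; apply: bijective_ring_iso.
- exists (fun Y => unflatten_mx (G *m flatten_mx (swap_levels Y) *m H)) => Y.
    rewrite swap_levelsK unflatten_mxK !mulmxA GH mul1mx -mulmxA GH mulmx1.
    exact: flatten_mxK.
  by rewrite unflatten_mxK !mulmxA HG mul1mx -mulmxA HG mulmx1 flatten_mxK swap_levelsK.
- by move=> Y Z; rewrite flatten_mxD mulmxDr mulmxDl unflatten_mxD swap_levelsD.
- move=> Y Z; rewrite flatten_mxM -swap_levelsM -unflatten_mxM -!mulmxE.
  by rewrite !mulmxA -[_ *m G *m H]mulmxA GH mulmx1.
Qed.

(** * Matrices over a division ring *)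

Section DivisionRing.
Variable D : unitRingType.
Hypothesis divD : forall t : D, t != 0 -> t \is a GRing.unit.

Lemma division_mx_simple r (z : 'M[D]_r) :
  z != 0 -> exists a b : 'I_r -> 'M[D]_r, \sum_w a w * z * b w = 1.
Proof.
case/matrix0Pn=> u [v zuv].
exists (fun w => (z u v)^-1 *: delta_mx w u), (fun w => 1 *: delta_mx v w).
rewrite -[1 in RHS]/(1%:M) scalar_mx_sum_delta; apply: eq_bigr => w _.
by rewrite -!mulmxE mul_delta_mx_delta mulVr ?divD // mul1r.
Qed.

Lemma mulmx_col'_row' m n k (i : 'I_m.+1) (M : 'M[D]_(n, m.+1)) (N : 'M[D]_(m.+1, k)) :
  row i N = 0 -> col' i M *m row' i N = M *m N.
Proof.
move/rowP=> Ni0; apply/matrixP => s t; rewrite [RHS]mxE (bigD1_ord i) //= mxE.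
have := Ni0 t; rewrite !mxE => ->; rewrite mulr0 add0r.
by apply: eq_bigr => q _; rewrite !mxE.
Qed.

(* Gaussian elimination: for each column [y] of [Y] which [C] does not kill, the
   row [a] with [a *m y = 1] splits off one dimension of the cokernel. *)
Lemma division_cokernel_split k l (Y : 'M[D]_(k, l)) :
  exists m (C : 'M_(m, k)) (C' : 'M_(k, m)) (Z : 'M_(l, k)),
  [/\ C *m Y = 0, C *m C' = 1%:M & C' *m C + Y *m Z = 1%:M].
Proof.
elim: l Y => [Y|l IHl].
  exists k, 1%:M, 1%:M, 0; rewrite !mul1mx mulmx0 addr0; split=> //.
  by apply/matrixP => i [].
rewrite -[l.+1]/(1 + l)%N => Y; rewrite -[Y]hsubmxK.
set y := lsubmx _; set Y' := rsubmx _.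
have [m [C [C' [Z [CY CC' CYZ]]]]] := IHl Y'.
case: (eqVneq (C *m y) 0) => [Cy0|/matrix0Pn [i [j Cyi]]].
  exists m, C, C', (col_mx (0 : 'rV_k) Z); split=> //.
    by rewrite mul_mx_row Cy0 CY row_mx0.
  by rewrite mul_row_col mulmx0 add0r.
rewrite (ord1 j) in Cyi; case: m C C' CY CC' CYZ i Cyi => [|m] C C' CY CC' CYZ i Cyi.
  by case: i {Cyi}.
pose a := ((C *m y) i 0)^-1 *: row i C; pose C1 := C - C *m y *m a.
have ay : a *m y = 1%:M.
  rewrite -scalemxAl -row_mul; apply/matrixP => s t; rewrite !ord1 mxE.
  by rewrite [row _ _ _ _]mxE mulVr ?divD // mxE eqxx.
have aY' : a *m Y' = 0 by rewrite -scalemxAl -row_mul CY row0 scaler0.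
have C1i : row i C1 = 0.
  rewrite linearB /= row_mul [row i (C *m y)]mx11_scalar [row _ _ _ _]mxE.
  by rewrite mul_scalar_mx scalerA mulrV ?divD // scale1r subrr.
exists m, (row' i C1), (col' i C'), (col_mx a (Z - Z *m y *m a)); split.
- rewrite row'Esub mul_rowsub_mx mul_mx_row !mulmxBl CY -!mulmxA ay aY' mulmx1.
  by rewrite !mulmx0 !subrr row_mx0; apply/matrixP => s t; rewrite !mxE.
- rewrite row'Esub col'Esub -mxsub_mul mulmxBl CC' -[_ *m a *m _]mulmxA.
  rewrite -scalemxAl -row_mul CC'; apply/matrixP => s t.
  rewrite mxE [LHS]mxE [X in _ + X]mxE [X in _ - X]mxE big_ord1.
  by rewrite !mxE (inj_eq lift_inj) (negPf (neq_lift i t)) !mulr0 subr0.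
- rewrite mulmx_col'_row' // mul_row_col !mulmxBr !mulmxA addrCA addrACA -opprD.
  by rewrite -!mulmxDl CYZ mul1mx addrC subrK.
Qed.

End DivisionRing.

(** * Reduction modulo an ideal with simple artinian quotient *)

Definition residue_hom (A C : pzRingType) (S P : A -> Prop) (phi : A -> C) :=
  [/\ additive_on S phi,
      forall x y, S x -> S y -> phi (x * y) = phi x * phi y, phi 1 = 1,
      forall z, exists x, S x /\ phi x = z & forall x, S x -> (phi x = 0 <-> P x)].

Section ResidueHom.
Variables (A C : pzRingType) (S P : A -> Prop) (phi : A -> C).
Hypotheses (sS : subring_of S) (PS : forall x, P x -> S x).
Hypothesis homP : residue_hom S P phi.

Let gS : subgroup_of S := subring_subgroup sS.
Let SM : lstable S S. Proof. by case: sS. Qed.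

Lemma residue_eq x y : S x -> S y -> phi x = phi y -> P (x - y).
Proof.
case: homP => phiD _ _ _ phiP Sx Sy E; apply/phiP; first exact: subgroupB.
by rewrite (additive_onB gS phiD) // E subrr.
Qed.

Lemma residue_ideal : ideal_of S P.
Proof.
case: homP => phiD phiM _ _ phiP; split=> //; first split.
- by apply/phiP; [apply: subgroup0 | apply: additive_on0 phiD].
- move=> x y Px Py; have [Sx Sy] := (PS Px, PS Py); apply/phiP; first exact: subgroupB.
  by rewrite (additive_onB gS phiD) // !(proj2 (phiP _ _)) // subr0.
- move=> s x Ss Px; have Sx := PS Px; apply/phiP; first exact: SM.
  by rewrite phiM // (proj2 (phiP _ Sx)) // mulr0.
- move=> s x Ss Px; have Sx := PS Px; apply/phiP; first exact: SM.
  by rewrite phiM // (proj2 (phiP _ Sx)) // mul0r.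
Qed.

End ResidueHom.

Section MatrixResidue.
Variables (A : pzRingType) (S P : A -> Prop) (D : unitRingType) (r : nat).
Variable phi : A -> 'M[D]_r.
Hypotheses (sS : subring_of S) (PS : forall x, P x -> S x).
Hypothesis homP : residue_hom S P phi.
Hypothesis divD : forall t : D, t != 0 -> t \is a GRing.unit.

Let gS : subgroup_of S := subring_subgroup sS.
Let SM : lstable S S. Proof. by case: sS. Qed.
Let S1 : S 1. Proof. by case: sS. Qed.
Let iP : ideal_of S P := residue_ideal sS PS homP.
Let gP : subgroup_of P. Proof. by case: iP. Qed.
Let lP : lstable S P. Proof. by case: iP. Qed.
Let phiM x y : S x -> S y -> phi (x * y) = phi x * phi y.
Proof. by case: homP => _ + _ _ _; apply. Qed.
Let gmS m n := mx_in_subgroup m n gS.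

Lemma residue_two_sided_unit a : S a -> ~ P a ->
  exists l t : 'I_r -> A, [/\ forall w, S (l w), forall w, S (t w)
    & P (1 - \sum_w l w * a * t w)].
Proof.
case: homP => phiD _ phi1 phi_surj phiP Sa nPa.
have /(division_mx_simple divD) [l0 [t0 l0t0]] : phi a != 0.
  by apply/eqP => /(phiP _ Sa).
have [l lE] := fin_all_exists (fun w => phi_surj (l0 w)).
have [t tE] := fin_all_exists (fun w => phi_surj (t0 w)).
have Sl w : S (l w) by case: (lE w).
have St w : S (t w) by case: (tE w).
have Slat w : S (l w * a * t w) by do 2!apply: SM => //.
exists l, t; split=> //; apply: (residue_eq sS homP) => //; first exact: subgroup_sum.
rewrite phi1 (additive_on_sum gS phiD) // -l0t0; apply: eq_bigr => w _.
by rewrite !phiM //; [case: (lE w) (tE w) => _ -> [_ ->] | apply: SM].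
Qed.

Lemma mx_residue_largest_ideal n : left_quasiregular S P -> (0 < n)%N -> ~ P 1 ->
  largest_proper_ideal (@mx_over A n S) (@mx_over A n P).
Proof.
move=> qP n_gt0 nP1; have imP := mx_over_ideal n iP; split=> // [P1|I iI nI1 M IM i j].
  by apply: nP1; have := P1 (Ordinal n_gt0) (Ordinal n_gt0); rewrite mxE eqxx.
have [IS gI lI _] := iI; apply: NNPP => nPij.
have [l [t [Sl St P1s]]] := residue_two_sided_unit (IS _ IM i j) nPij.
set s := \sum_w _ in P1s.
have Is : I s%:M.
  by rewrite rmorph_sum; apply: (subgroup_sum gI) => w _; apply: mx_ideal_entry iI IM _ _.
have [|z zS [zs1 _]] := mx_invertible_mod (n := n) (M := s%:M) sS iP qP.
  by rewrite -rmorphB; apply: mx_in_scalar.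
by apply: nI1; rewrite -[1]zs1; apply: lI.
Qed.

(** * Residue coordinates *)

(* [psi] induces an isomorphism of right [M_r(D)]-modules between [S^n / x S^n]
   and the sum of [m] copies of the row space [D^r]. *)
Definition residue_coords n m (x : 'M[A]_n) (psi : 'cV[A]_n -> 'M[D]_(m, r)) :=
  [/\ additive_on (@mx_in A n 1 S) psi,
      forall v s, mx_in S v -> S s -> psi (v *m s%:M) = psi v *m phi s,
      forall z, exists v, mx_in S v /\ psi v = z &
      forall v, mx_in S v -> (psi v = 0 <-> exists2 u, mx_in S u & v = x *m u)].

Definition residue_col n (v : 'cV[A]_n) : 'M[D]_(\sum_(i < n) r, r) := \mxcol_i phi (v i 0).

Section ResidueCol.
Variable n : nat.
Implicit Types u v : 'cV[A]_n.

Lemma residue_colD : additive_on (@mx_in A n 1 S) (@residue_col n).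
Proof.
case: homP => phiD _ _ _ _ u v uS vS.
by rewrite -mxcolD; apply: eq_mxcol => i; rewrite mxE phiD.
Qed.

Lemma residue_colM (x : 'M[A]_n) v : mx_in S x -> mx_in S v ->
  residue_col (x *m v) = (\mxblock_(i < n, j < n) phi (x i j)) *m residue_col v.
Proof.
case: homP => phiD _ _ _ _ xS vS; rewrite mul_mxblock_mxrow; apply: eq_mxcol => i.
rewrite mxE (additive_on_sum gS phiD) => [|j]; last exact: SM.
by apply: eq_bigr => j _; rewrite phiM.
Qed.

Lemma residue_col_scale v s : mx_in S v -> S s ->
  residue_col (v *m s%:M) = residue_col v *m phi s.
Proof.
move=> vS Ss; rewrite mxcol_mul; apply: eq_mxcol => i.
by rewrite mxE big_ord1 mxE eqxx mulr1n phiM.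
Qed.

Lemma residue_col_surj z : exists v, mx_in S v /\ residue_col v = z.
Proof.
case: homP => _ _ _ phi_surj _.
have [v vP] := fin_all_exists (fun i => phi_surj (submxcol z i)).
exists (\col_i v i); split; first by move=> i j; rewrite mxE; case: (vP i).
by rewrite -[z]submxcolK; apply: eq_mxcol => i; rewrite mxE; case: (vP i).
Qed.

Lemma residue_col_eq0 v : mx_in S v -> (residue_col v = 0 <-> mx_in P v).
Proof.
case: homP => _ _ _ _ phiP vS; rewrite /residue_col -mxcol0; split.
  by move/eq_mxcolP => v0 i j; rewrite ord1; apply/phiP.
by move=> vP; apply: eq_mxcol => i; apply/phiP.
Qed.

End ResidueCol.

Lemma residue_coords_exists n (x : 'M[A]_n) : mx_in S x ->
  (forall v : 'cV_n, mx_in P v -> exists2 u, mx_in S u & v = x *m u) ->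
  exists m (psi : 'cV[A]_n -> 'M[D]_(m, r)), residue_coords x psi.
Proof.
move=> xS Px; pose Y := \mxblock_(i < n, j < n) phi (x i j).
have [m [C [C' [Z [CY CC' CYZ]]]]] := division_cokernel_split divD Y.
exists m, (fun v => C *m residue_col v); split.
- by move=> u v uS vS; rewrite residue_colD // mulmxDr.
- by move=> v s vS Ss; rewrite residue_col_scale // mulmxA.
- move=> z; have [v [vS vE]] := residue_col_surj (C' *m z); exists v; split=> //.
  by rewrite vE mulmxA CC' mul1mx.
- move=> v vS; split=> [Cv0|[u uS ->]]; last by rewrite residue_colM // mulmxA CY mul0mx.
  have [u [uS uE]] := residue_col_surj (Z *m residue_col v).
  have xuS : mx_in S (x *m u) by apply: mx_in_mul.
  have [|w wS wE] := Px (v - x *m u).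
    apply/residue_col_eq0; first exact: (subgroupB (gmS _ _)).
    rewrite (additive_onB (gmS _ _) (@residue_colD n)) // residue_colM // uE mulmxA.
    by rewrite -[X in X - _]mul1mx -CYZ -mulmxBl addrK -mulmxA Cv0 mulmx0.
  exists (u + w); first exact: (subgroupD (gmS _ _)).
  by rewrite mulmxDr -wE addrC subrK.
Qed.

Lemma residue_coords_dim0 n (x : 'M[A]_n) (psi : 'cV[A]_n -> 'M[D]_(0, r)) k (v : 'cV_n) :
  residue_coords x psi -> mx_in S v -> exists2 u, mx_in S u & v = x ^+ k *m u.
Proof.
case=> _ _ _ psi0; elim: k v => [|k IHk] v vS; first by exists v; rewrite // expr0 mul1mx.
have [u uS ->] := IHk v vS; have [|w wS ->] := proj1 (psi0 u uS).
  by apply/matrixP => -[].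
by exists w; rewrite // exprSr -mulmxE mulmxA.
Qed.

Lemma residue_coords_copies b n m (x : 'M[A]_n) (psi : 'cV[A]_n -> 'M[D]_(m, r)) :
  mx_in S x -> residue_coords x psi ->
  residue_coords (copies_mx b x) (fun v => \mxcol_(i < b) psi (submxcol v i)).
Proof.
move=> xS [psiD psiZ psi_surj psi0].
have colS (v : 'cV_(\sum_(i < b) n)) : mx_in S v -> forall i, mx_in S (submxcol v i).
  by rewrite -{1}[v]submxcolK => /mx_in_mxcol.
split.
- move=> u v uS vS; rewrite -mxcolD; apply: eq_mxcol => i.
  by rewrite submxcolD psiD //; apply: colS.
- move=> v s vS Ss; rewrite mxcol_mul; apply: eq_mxcol => i.
  by rewrite -submxcol_mul psiZ //; apply: colS.
- move=> z; have [v vP] := fin_all_exists (fun i => psi_surj (submxcol z i)).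
  exists (\mxcol_i v i); split; first by apply/mx_in_mxcol => i; case: (vP i).
  by rewrite -[z]submxcolK; apply: eq_mxcol => i; rewrite mxcolK; case: (vP i).
- move=> v vS; rewrite -mxcol0; split=> [/eq_mxcolP psiv0|[u uS ->]].
    have [u uS vE] := fin_all_exists2 (fun i => proj1 (psi0 _ (colS v vS i)) (psiv0 i)).
    exists (\mxcol_i u i); first exact/mx_in_mxcol.
    by rewrite copies_mx_mxcol -[v]submxcolK; apply: eq_mxcol.
  apply: eq_mxcol => i; have uiS := colS u uS i.
  rewrite -[u]submxcolK copies_mx_mxcol mxcolK; apply/psi0; last by exists (submxcol u i).
  exact: mx_in_mul.
Qed.

(* The columns of [F] form a basis of the right [S/P]-module [S^N / X S^N]. *)
Definition basis_modulo N c (X : 'M[A]_N) (F : 'M[A]_(N, c)) := [/\ mx_in S F,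
  forall v : 'cV_N, mx_in S v ->
    exists t u, [/\ mx_in S t, mx_in S u & v = F *m t + X *m u] &
  forall (t : 'cV_c) (u : 'cV_N), mx_in S t -> mx_in S u -> F *m t = X *m u -> mx_in P t].

Lemma residue_coords_mul N m c (X : 'M[A]_N) (psi : 'cV[A]_N -> 'M[D]_(m, r))
    (F : 'M[A]_(N, c)) (t : 'cV[A]_c) : residue_coords X psi -> mx_in S F -> mx_in S t ->
  psi (F *m t) = \sum_j psi (col j F) *m phi (t j 0).
Proof.
case=> psiD psiZ _ _ FS tS; have colS j : mx_in S (col j F) by move/mx_in_col: FS.
have -> : F *m t = \sum_j col j F *m (t j 0)%:M.
  apply/matrixP => i k; rewrite ord1 mxE summxE; apply: eq_bigr => j _.
  by rewrite mxE big_ord1 !mxE eqxx.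
rewrite (additive_on_sum (gmS _ _) psiD) => [|j].
  by apply: eq_bigr => j _; apply: psiZ.
by apply: mx_in_mul => //; apply: mx_in_scalar.
Qed.

Lemma residue_coords_basis N m c (X : 'M[A]_N) (psi : 'cV[A]_N -> 'M[D]_(m, r)) :
  m = (\sum_(j < c) r)%N -> residue_coords X psi ->
  mx_in S X -> exists F : 'M[A]_(N, c), basis_modulo X F.
Proof.
move=> mE; subst m => coords XS; have [psiD _ psi_surj psi0] := coords.
pose unit_col j : 'M[D]_(\sum_(j < c) r, r) :=
  \mxcol_(i < c) (if i == j then (1%:M : 'M_r) else 0).
have [f fP] := fin_all_exists (fun j => psi_surj (unit_col j)).
pose F := \matrix_(i, j) f j i 0.
have colF j : col j F = f j by apply/matrixP => i k; rewrite !mxE ord1.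
have FS : mx_in S F by apply/mx_in_col => j; rewrite colF; case: (fP j).
have psiF t : mx_in S t -> psi (F *m t) = residue_col t.
  move=> tS; rewrite (residue_coords_mul coords) //.
  transitivity (\sum_j \mxcol_(i < c) ((if i == j then 1%:M else 0) *m phi (t j 0))).
    by apply: eq_bigr => j _; rewrite colF (proj2 (fP j)) mxcol_mul.
  rewrite -mxcol_sum; apply: eq_mxcol => i.
  rewrite (bigD1 i) //= eqxx mul1mx big1 ?addr0 // => j ji.
  by rewrite eq_sym (negPf ji) mul0mx.
exists F; split=> // [v vS|t u tS uS FtXu].
- have [t [tS tE]] := residue_col_surj (psi v); have FtS := mx_in_mul sS FS tS.
  have vFtS := subgroupB (gmS _ _) vS FtS; have [|u uS E] := proj1 (psi0 _ vFtS).
    by rewrite (additive_onB (gmS _ _) psiD) // psiF // tE subrr.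
  by exists t, u; split=> //; rewrite -E addrC subrK.
- apply/residue_col_eq0 => //; rewrite -psiF // FtXu; apply/psi0; last by exists u.
  exact: mx_in_mul.
Qed.

Lemma copies_basis_exists n d (x : 'M[A]_n) : (0 < n)%N -> ~ P 1 -> mx_in S x ->
  (forall v : 'cV_n, mx_in P v <-> exists2 u, mx_in S u & v = x ^+ d *m u) -> (0 < d)%N ->
  exists b c (F : 'M[A]_(\sum_(i < b) n, c)),
    [/\ (b %| r)%N, (0 < c)%N & basis_modulo (copies_mx b x) F].
Proof.
move=> n_gt0 nP1 xS Px d_gt0.
have [|m [psi coords]] := residue_coords_exists xS.
  move=> v /Px [u uS ->]; exists (x ^+ d.-1 *m u).
    by apply: mx_in_mul => //; apply: (subringX (mx_over_subring n sS) _ xS).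
  by rewrite mulmxA mulmxE -exprS prednK.
have m_gt0 : (0 < m)%N.
  case: m psi coords => // psi /residue_coords_dim0 coords0; case: nP1.
  have [|u uS E] := coords0 d (const_mx 1); first by move=> i j; rewrite mxE.
  have : mx_in P (const_mx 1 : 'cV[A]_n) by apply/Px; exists u.
  by move/(_ (Ordinal n_gt0) 0); rewrite mxE.
have g_gt0 : (0 < gcdn m r)%N by rewrite gcdn_gt0 m_gt0.
pose b := (r %/ gcdn m r)%N; pose c := (m %/ gcdn m r)%N.
have bmcr : (\sum_(i < b) m = \sum_(j < c) r)%N.
  by rewrite !sum_nat_const !card_ord mulnC -[RHS]mulnC muln_divCA_gcd.
have copiesS : mx_in S (copies_mx b x) by apply: mx_in_copies.
have [F basisF] :=
  residue_coords_basis bmcr (residue_coords_copies b xS coords) copiesS.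
exists b, c, F; split=> //.
- by rewrite -[X in (_ %| X)%N](divnK (dvdn_gcdr m r)) dvdn_mulr.
- by rewrite divn_gt0 // dvdn_leq ?dvdn_gcdl.
Qed.

End MatrixResidue.

(** * Bases adapted to a lattice chain *)

Definition col_chain (A : pzRingType) (S : A -> Prop) N (X : 'M[A]_N) i (v : 'cV[A]_N) :=
  exists2 u, mx_in S u & v = X ^+ i *m u.

Definition block_triangular (A : Type) (S P : A -> Prop) d c
    (Y : 'M[A]_(\sum_(k < d) c)) :=
  forall k l, mx_in S (submxblock Y k l) /\ ((l < k)%N -> mx_in P (submxblock Y k l)).

Section AdaptedBasis.
Variables (A : pzRingType) (S P : A -> Prop) (N d c : nat).
Variables (X XV : 'M[A]_N) (F : 'M[A]_(N, c)).
Hypotheses (sS : subring_of S) (iP : ideal_of S P) (qP : left_quasiregular S P).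
Hypotheses (XS : mx_in S X) (XVX : XV * X = 1) (basisF : basis_modulo S P X F).

Let chain_col := col_chain S X.

Hypothesis chain_d : forall v, mx_in P v <-> chain_col d v.

Let gS : subgroup_of S := subring_subgroup sS.
Let PS : forall a, P a -> S a. Proof. by case: iP. Qed.
Let gP : subgroup_of P. Proof. by case: iP. Qed.
Let lP : lstable S P. Proof. by case: iP. Qed.
Let gmS m n := mx_in_subgroup m n gS.
Let FS : mx_in S F. Proof. by case: basisF. Qed.

Let XkS k : mx_in S (X ^+ k).
Proof. exact: (subringX (mx_over_subring N sS) k XS). Qed.

Lemma col_chain_subgroup i : subgroup_of (chain_col i).
Proof.
split; first by exists 0; rewrite ?mulmx0 //; apply: (subgroup0 (gmS _ _)).
move=> _ _ [u uS ->] [v vS ->]; exists (u - v); last by rewrite mulmxBr.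
exact: (subgroupB (gmS _ _)).
Qed.

Lemma col_chain_le i j v : (i <= j)%N -> chain_col j v -> chain_col i v.
Proof.
move=> ij [u uS ->]; exists (X ^+ (j - i) *m u); first exact: mx_in_mul.
by rewrite mulmxA mulmxE -exprD subnKC.
Qed.

Lemma col_chain_mx_in i v : chain_col i v -> mx_in S v.
Proof. by case=> u uS ->; apply: mx_in_mul. Qed.

Definition adapted_mx : 'M[A]_(N, \sum_(k < d) c) := \mxrow_(k < d) (X ^+ rev_ord k *m F).

Lemma adapted_mx_in : mx_in S adapted_mx.
Proof. by move=> i a; rewrite mxE; apply: mx_in_mul. Qed.

Lemma mul_adapted_mx (u : 'cV[A]_(\sum_(k < d) c)) :
  adapted_mx *m u = \sum_(k < d) X ^+ rev_ord k *m (F *m submxcol u k).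
Proof.
rewrite -{1}[u]submxcolK mul_mxrow_mxcol.
by apply: eq_bigr => k _; rewrite mulmxA.
Qed.

(* Column [k] of the adapted basis lies in step [rev_ord k] of the chain, so
   these are the coordinates of step [i]. *)
Definition flag_col i (u : 'cV[A]_(\sum_(k < d) c)) := forall k : 'I_d,
  mx_in S (submxcol u k) /\ ((rev_ord k < i)%N -> mx_in P (submxcol u k)).

Lemma col_chain_term i (k : 'I_d) (y : 'cV_c) : (i <= d)%N -> mx_in S y ->
  ((rev_ord k < i)%N -> mx_in P y) -> chain_col i (X ^+ rev_ord k *m (F *m y)).
Proof.
move=> id yS yP; case: (ltnP (rev_ord k) i) => [ki|ik].
  apply: (col_chain_le id); apply/chain_d.
  by do 2!apply: (mx_in_mull gP lP) => //; apply: yP.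
by apply: (col_chain_le ik); exists (F *m y) => //; apply: mx_in_mul.
Qed.

Lemma flag_col_chain i u : (i <= d)%N -> flag_col i u -> chain_col i (adapted_mx *m u).
Proof.
move=> id fu; rewrite mul_adapted_mx; apply: (subgroup_sum (col_chain_subgroup i)) => k _.
by apply: col_chain_term => //; case: (fu k).
Qed.

Lemma expr_mulVmx k (v : 'cV[A]_N) : XV ^+ k *m (X ^+ k *m v) = v.
Proof. by rewrite mulmxA (exprVK k XVX : _ *m _ = _) mul1mx. Qed.

Lemma flag_col_of_chain i u :
  (i <= d)%N -> mx_in S u -> chain_col i (adapted_mx *m u) -> flag_col i u.
Proof.
have [_ _ freeF] := basisF.
move=> + uS; elim: i => [|i IHi] id Gu k.
  by split=> // a b; rewrite mxE; apply: uS.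
have fu := IHi (ltnW id) (col_chain_le (leqnSn i) Gu); have [ukS ukP] := fu k.
split=> //; rewrite ltnS leq_eqVlt => /orP [/eqP ki|]; last exact: ukP.
have [w wS wE] : chain_col i.+1 (X ^+ i *m (F *m submxcol u k)).
  have gX := col_chain_subgroup i.+1.
  move: Gu; rewrite mul_adapted_mx (bigD1 k) // ki => Gu.
  pose rest := \sum_(j < d | j != k) X ^+ rev_ord j *m (F *m submxcol u j).
  apply: (subgroupBl gX (y := - rest)); first by rewrite opprK.
  apply: (subgroupN gX); apply: (subgroup_sum gX) => j jk.
  have [ujS ujP] := fu j; apply: col_chain_term => //.
  rewrite ltnS leq_eqVlt => /orP [/eqP ji|]; last exact: ujP.
  by case/eqP: jk; apply/rev_ord_inj/val_inj/(etrans ji).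
apply: (freeF _ _ ukS wS); apply/(can_inj (expr_mulVmx i)).
by rewrite wE exprSr -mulmxE mulmxA.
Qed.

Lemma adapted_mx_span i v : (i <= d)%N -> mx_in S v ->
  exists2 u, mx_in S u & chain_col i (v - adapted_mx *m u).
Proof.
have [_ spanF _] := basisF.
move=> + vS; elim: i => [|i IHi] id.
  exists 0; first exact: (subgroup0 (gmS _ _)).
  by exists v => //; rewrite mulmx0 subr0 expr0 mul1mx.
have [u uS [v' v'S E]] := IHi (ltnW id); have [t [w [tS wS v'E]]] := spanF _ v'S.
pose k := rev_ord (Ordinal id).
pose y : 'cV[A]_(\sum_(k < d) c) := \mxcol_j (if j == k then t else 0).
have yS : mx_in S y.
  by apply/mx_in_mxcol => j; case: eqP => // _; apply: (subgroup0 (gmS _ _)).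
exists (u + y); first exact: (subgroupD (gmS _ _)).
exists w => //; rewrite mulmxDr opprD addrA E v'E.
have -> : adapted_mx *m y = X ^+ i *m (F *m t).
  rewrite mul_adapted_mx (bigD1 k) // mxcolK eqxx rev_ordK.
  by rewrite big1 /= ?addr0 // => j jk; rewrite mxcolK (negPf jk) !mulmx0.
by rewrite mulmxDr addrC addKr exprSr -mulmxE mulmxA.
Qed.

Lemma adapted_mx_inverse : exists H : 'M[A]_(\sum_(k < d) c, N),
  [/\ mx_in S H, adapted_mx *m H = 1%:M & H *m adapted_mx = 1%:M].
Proof.
have mx1S n : mx_in S (1%:M : 'M_n) by apply: mx_in_scalar => //; case: sS.
have [u uS uE] := fin_all_exists2 (fun a =>
  adapted_mx_span (leqnn d) (proj1 (mx_in_col _ _) (mx1S N) a)).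
pose U := \matrix_(i, a) u a i 0.
have US : mx_in S U by move=> i a; rewrite mxE; apply: uS.
have [|t tS [_ GUt]] := mx_invertible_mod (M := adapted_mx *m U) sS iP qP.
  apply/mx_in_col => a; rewrite linearB /= mulmx_col; apply/chain_d.
  by rewrite (_ : col a U = u a) //; apply/matrixP => i j; rewrite !mxE ord1.
set H := U *m t; have GH : adapted_mx *m H = 1%:M by rewrite mulmxA.
have HS : mx_in S H by apply: mx_in_mul.
exists H; split=> //; pose Q := 1%:M - H *m adapted_mx.
have GQ : adapted_mx *m Q = 0 by rewrite mulmxBr mulmx1 mulmxA GH mul1mx subrr.
have QS : mx_in S Q.
  by apply: (subgroupB (gmS _ _)) => //; apply: mx_in_mul => //; apply: adapted_mx_in.
have QP : mx_in P Q.
  apply/mx_in_col => b; rewrite -[col b Q]submxcolK; apply/mx_in_mxcol => k.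
  have [||_] := flag_col_of_chain (leqnn d) (u := col b Q) _ _ k.
  - by move/mx_in_col: QS; apply.
  - by rewrite -mulmx_col GQ col0; apply: (subgroup0 (col_chain_subgroup d)).
  - by apply; rewrite /= ltn_subrL /= (leq_ltn_trans _ (ltn_ord k)).
have [s _ [sHG _]] := mx_invertible_mod sS iP qP QP.
have idem : H *m adapted_mx *m (H *m adapted_mx) = H *m adapted_mx.
  by rewrite mulmxA -[H *m _ *m H]mulmxA GH mulmx1.
by rewrite -[LHS]mul1mx -{1}sHG -mulmxA idem.
Qed.

Lemma flag_col_mul i (Y : 'M[A]_(\sum_(k < d) c)) u :
  block_triangular S P Y -> flag_col i u -> flag_col i (Y *m u).
Proof.
have [_ _ _ rP] := iP; move=> triY fu k.
have -> : submxcol (Y *m u) k = \sum_l submxblock Y k l *m submxcol u l.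
  by rewrite -{1}[Y]submxblockK -{1}[u]submxcolK mul_mxblock_mxrow mxcolK.
split=> [|ki].
  apply: (subgroup_sum (gmS _ _)) => l _.
  by apply: mx_in_mul => //; [case: (triY k l) | case: (fu l)].
apply: (subgroup_sum (mx_in_subgroup _ _ gP)) => l _.
have [[YS YP] [uS uP]] := (triY k l, fu l); case: (ltnP l k) => [lk|kl].
  exact: (mx_in_mulr gP rP (YP lk) uS).
by apply: (mx_in_mull gP lP YS); apply: uP; apply: leq_ltn_trans ki; rewrite leq_sub2l.
Qed.

Lemma adapted_mx_conj H (Z : 'M[A]_N) :
  mx_in S H -> adapted_mx *m H = 1%:M -> H *m adapted_mx = 1%:M ->
  (forall i, (i < d)%N -> forall v, chain_col i v -> chain_col i (Z *m v)) <->
  block_triangular S P (H *m Z *m adapted_mx).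
Proof.
move=> HS GH HG; set Y := H *m Z *m adapted_mx.
have GY : adapted_mx *m Y = Z *m adapted_mx by rewrite /Y !mulmxA GH mul1mx.
split=> [stab k l|triY i id v iv].
  pose unit_col j : 'cV[A]_(\sum_(k < d) c) := \mxcol_k (if k == l then col j 1%:M else 0).
  have flag_unit_col j : flag_col (rev_ord l) (unit_col j).
    move=> k'; rewrite mxcolK; case: eqP => [->|_].
      rewrite ltnn; split=> //; move: j; apply/mx_in_col.
      by apply: mx_in_scalar => //; case: sS.
    by split=> [|_]; apply: subgroup0; apply: mx_in_subgroup.
  have rev_lt := ltn_ord (rev_ord l).
  have flag_Yunit_col j : flag_col (rev_ord l) (Y *m unit_col j).
    have Gu := flag_col_chain (ltnW rev_lt) (flag_unit_col j).
    have GYu : chain_col (rev_ord l) (adapted_mx *m (Y *m unit_col j)).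
      by rewrite mulmxA GY -mulmxA; apply: stab.
    apply: (flag_col_of_chain (ltnW rev_lt) _ GYu).
    have := mx_in_mul sS HS (col_chain_mx_in GYu).
    by rewrite mulmxA HG mul1mx.
  have colY j : col j (submxblock Y k l) = submxcol (Y *m unit_col j) k.
    rewrite -{2}[Y]submxblockK mul_mxblock_mxrow mxcolK (bigD1 l) //= eqxx.
    rewrite -mulmx_col mulmx1.
    by rewrite big1 ?addr0 // => l' /negPf ->; rewrite mulmx0.
  split=> [|lk]; apply/mx_in_col => j; rewrite colY.
    by case: (flag_Yunit_col j k).
  have [_ YP] := flag_Yunit_col j k.
  by apply: YP; rewrite /= ltn_sub2l // (leq_ltn_trans lk).
have uE : adapted_mx *m (H *m v) = v by rewrite mulmxA GH mul1mx.
rewrite -uE mulmxA -GY -mulmxA; apply: (flag_col_chain (ltnW id)).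
apply: flag_col_mul => //.
apply: (flag_col_of_chain (ltnW id)); last by rewrite uE.
exact: (mx_in_mul sS HS (col_chain_mx_in iv)).
Qed.

End AdaptedBasis.

(** * Orders stabilising a lattice chain *)

Section ColumnChain.
Variables (A : pzRingType) (S : A -> Prop) (n : nat) (x : 'M[A]_n).

Lemma chain_col i (V : 'M[A]_n) :
  chain (@mx_over A n S) x i V <-> forall j, col_chain S x i (col j V).
Proof.
split=> [[U US ->] j|/fin_all_exists2 [u uS uE]].
  by exists (col j U); [move/mx_in_col: US; apply | rewrite mulmx_col].
exists (\matrix_(k, j) u j k 0); first by move=> k j; rewrite mxE; apply: uS.
apply/matrixP => k j; have /matrixP /(_ k 0) := uE j; rewrite !mxE => ->.
by apply: eq_bigr => l _; rewrite [X in _ = _ * X]mxE.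
Qed.

Hypothesis n_gt0 : (0 < n)%N.

Lemma col_mul_const1 (v : 'cV[A]_n) (j : 'I_n) : col j (v *m const_mx 1) = v.
Proof. by apply/matrixP => i k; rewrite ord1 !mxE big_ord1 mxE mulr1. Qed.

Lemma chain_mul_const1 i (v : 'cV[A]_n) :
  chain (@mx_over A n S) x i (v *m const_mx 1) <-> col_chain S x i v.
Proof.
by rewrite chain_col; split=> [/(_ (Ordinal n_gt0))|iv j]; rewrite col_mul_const1.
Qed.

Lemma mx_over_mul_const1 (Q : A -> Prop) (v : 'cV[A]_n) :
  mx_over Q (v *m const_mx 1 : 'M_n) <-> mx_in Q v.
Proof.
rewrite -[mx_over _ _]/(mx_in _ _) mx_in_col.
by split=> [/(_ (Ordinal n_gt0))|vQ j]; rewrite col_mul_const1.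
Qed.

Lemma chain_stabilizer_col d a : chain_stabilizer (@mx_over A n S) x d a <->
  forall i, (i < d)%N -> forall v, col_chain S x i v -> col_chain S x i (a *m v).
Proof.
split=> aP i id v; last first.
  by move/chain_col => vP; apply/chain_col => j; rewrite mulmx_col; apply: aP.
by rewrite -!chain_mul_const1 -mulmxA; apply: aP.
Qed.

Lemma col_chain_copies b i (v : 'I_b -> 'cV[A]_n) :
  col_chain S (copies_mx b x) i (\mxcol_k v k) <-> forall k, col_chain S x i (v k).
Proof.
rewrite /col_chain copies_mxX; split=> [[u uS vE] k|/fin_all_exists2 [u uS uE]].
  move: uS vE; rewrite -[u]submxcolK copies_mx_mxcol => /mx_in_mxcol uS /eq_mxcolP vE.
  by exists (submxcol u k).
exists (\mxcol_k u k); first exact/mx_in_mxcol.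
by rewrite copies_mx_mxcol; apply: eq_mxcol.
Qed.

Lemma flatten_mx_stable b i (Y : 'M['M[A]_n]_b) : subring_of S ->
  (forall v, col_chain S (copies_mx b x) i v ->
     col_chain S (copies_mx b x) i (flatten_mx Y *m v)) <->
  forall k l v, col_chain S x i v -> col_chain S x i (Y k l *m v).
Proof.
move=> sS; have gx := col_chain_subgroup x sS i; split=> [stab k l v iv|stab v].
  have /stab : col_chain S (copies_mx b x) i (\mxcol_j (if j == l then v else 0)).
    by apply/col_chain_copies => j; case: eqP => // _; apply: subgroup0 gx.
  rewrite mul_mxblock_mxrow => /col_chain_copies /(_ k).
  by rewrite (bigD1 l) //= eqxx big1 ?addr0 // => j /negPf ->; rewrite mulmx0.
rewrite -[v]submxcolK => /col_chain_copies iv.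
rewrite mul_mxblock_mxrow; apply/col_chain_copies => k.
by apply: (subgroup_sum gx) => l _; apply: stab.
Qed.

End ColumnChain.

Definition triangular_over (A : Type) (S P : A -> Prop) d (Y : 'M[A]_d) :=
  forall i j : 'I_d, ((i <= j)%N -> S (Y i j)) /\ ((j < i)%N -> P (Y i j)).

Lemma swap_levels_triangular (A : pzRingType) (S P : A -> Prop) c d
    (Z : 'M[A]_(\sum_(k < d) c)) : (forall a, P a -> S a) ->
  block_triangular S P Z <->
  mx_over (@triangular_over A S P d) (swap_levels (unflatten_mx Z)).
Proof.
have ZE i j k l : swap_levels (unflatten_mx Z) i j k l = submxblock Z k l i j.
  by rewrite !mxE.
move=> PS; split=> [ZP i j k l|ZP k l].
  by have [SZ PZ] := ZP k l; rewrite ZE; split=> [_|lk]; [apply: SZ | apply: PZ].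
split=> [i j|lk i j]; rewrite -ZE; have [SZ PZ] := ZP i j k l; last exact: PZ.
by case: (leqP k l) => [/SZ|/PZ/PS].
Qed.

Lemma chain_stabilizer_iso (A : pzRingType) (S P : A -> Prop) (D : unitRingType) r
    (phi : A -> 'M[D]_r) n d (x xV : 'M[A]_n) (L : 'M[A]_n -> Prop) :
  subring_of S -> (forall a, P a -> S a) -> ~ P 1 -> left_quasiregular S P ->
  (forall t : D, t != 0 -> t \is a GRing.unit) -> residue_hom S P phi ->
  (0 < n)%N -> (0 < d)%N -> mx_in S x -> xV * x = 1 ->
  (forall V, mx_over P V <-> chain (@mx_over A n S) x d V) ->
  (forall a, L a <-> chain_stabilizer (@mx_over A n S) x d a) ->
  exists b c : nat, [/\ (b %| r)%N, (0 < c)%N &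
    ring_iso (@mx_over _ b L) (@mx_over _ c (@triangular_over A S P d))].
Proof.
move=> sS PS nP1 qP divD homP n_gt0 d_gt0 xS xVx chainP stabL.
have iP := residue_ideal sS PS homP; have gS := subring_subgroup sS.
have Px (v : 'cV_n) : mx_in P v <-> col_chain S x d v.
  by rewrite -mx_over_mul_const1 // chainP chain_mul_const1.
have [b [c [F [b_dvd c_gt0 basisF]]]] :=
  copies_basis_exists sS homP divD n_gt0 nP1 xS Px d_gt0.
exists b, c; split=> //; pose X := copies_mx b x.
have XS : mx_in S X by apply: mx_in_copies.
have XVX : copies_mx b xV * X = 1 by rewrite copies_mxM xVx [LHS]flatten_mx1.
have PX (v : 'cV_(\sum_(i < b) n)) : mx_in P v <-> col_chain S X d v.
  rewrite -[v]submxcolK col_chain_copies mx_in_mxcol.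
  by split=> vP i; apply/Px.
have [H [HS GH HG]] := adapted_mx_inverse sS iP qP XS XVX basisF PX.
apply: (conj_ring_iso GH HG) => Y.
rewrite -swap_levels_triangular //.
rewrite -(adapted_mx_conj sS iP XS XVX basisF PX _ HS GH HG).
split=> [LY i id|stabY k l].
  by apply/flatten_mx_stable => // k l; have /stabL/chain_stabilizer_col := LY k l; apply.
apply/stabL/chain_stabilizer_col => // i id v.
by have /flatten_mx_stable := stabY i id; apply.
Qed.

(** * Orders in matrix algebras *)

Lemma is_order_ext (K : fieldType) (B : pzRingType) (sc sc' : K -> B -> B)
    (R : K -> Prop) (L : B -> Prop) :
  (forall k y, sc k y = sc' k y) -> is_order sc R L -> is_order sc' R L.
Proof.
move=> E [sL LR [s [sL1 sP]] LK]; split=> // [k y Rk Ly||y].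
- by rewrite -E; apply: LR.
- exists s; split=> // y /sP [c [cR cs ->]]; exists c; split=> //.
  by apply: eq_bigr => i _; rewrite E.
- by have [k [Rk k0 Lky]] := LK y; exists k; split=> //; rewrite -E.
Qed.

Section MatrixOrder.
Variables (K : fieldType) (A : falgType K) (n : nat).

Definition mx_iota : {rmorphism K -> 'M[A]_n} := @scalar_mx A n \o in_alg A.

Lemma mx_iota_scale k (M : 'M[A]_n) : mx_iota k * M = mx_scale k M.
Proof. by apply/matrixP => i j; rewrite /= -mulmxE mul_scalar_mx !mxE mulr_algl. Qed.

Lemma mx_iotaC k (M : 'M[A]_n) : mx_iota k * M = M * mx_iota k.
Proof.
apply/matrixP => i j; rewrite mx_iota_scale mxE -mulmxE mxE (bigD1 j) //= big1 => [|l lj].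
  by rewrite mxE eqxx mulr1n addr0 mulr_algr.
by rewrite mxE (negPf lj) mulr0n mulr0.
Qed.

Lemma in_algC k (a : A) : in_alg A k * a = a * in_alg A k.
Proof. by rewrite /= mulr_algl mulr_algr. Qed.

Lemma central_order_in_alg R Delta :
  is_order *:%R R Delta -> central_order R (in_alg A) Delta.
Proof. by apply: is_order_ext => k a; rewrite /= mulr_algl. Qed.

Lemma central_order_mx R Lambda :
  is_order (@mx_scale K A n) R Lambda -> central_order R mx_iota Lambda.
Proof. by apply: is_order_ext => k M; rewrite mx_iota_scale. Qed.

Lemma mx_over_clear_denominators R p Delta Lambda :
  subring_of R -> uniformizer R p -> is_order *:%R R Delta ->
  central_order R mx_iota Lambda ->
  exists t, forall g, mx_over Delta g -> Lambda (mx_iota (p ^+ t) * g).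
Proof.
move=> sR pR [_ _ [s [_ sP]] _] oL.
pose e (a : 'I_n * 'I_n * 'I_(size s)) : 'M[A]_n := s`_a.2 *: delta_mx a.1.1 a.1.2.
apply: (order_clear_denominators sR pR mx_iotaC oL (s := e)) => g gD.
have [c cP] := fin_all_exists (fun ij : 'I_n * 'I_n => sP _ (gD ij.1 ij.2)).
exists (fun a : 'I_n * 'I_n * 'I_(size s) => (c a.1)`_a.2).
  by move=> [ij k]; have [cR cs _] := cP ij; apply/cR/mem_nth; rewrite cs.
rewrite [LHS]matrix_sum_delta pair_bigA /=.
rewrite -(pair_bigA _ (fun ij (k : 'I_(size s)) => mx_iota (c ij)`_k * e (ij, k))) /=.
apply: eq_bigr => ij _; have [_ _ ->] := cP ij; rewrite scaler_suml.
apply: eq_bigr => k _; rewrite mx_iota_scale.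
by apply/matrixP => i j; rewrite !mxE scalerAl.
Qed.

End MatrixOrder.

Theorem theorem6p5 (K : fieldType) (R : K -> Prop) (A : falgType K)
    (Delta : A -> Prop) (r n d : nat) (Lambda : 'M[A]_n -> Prop) :
  is_DVR R ->
  (* A = K Delta is a K-central division algebra *)
  (forall x : A, x != 0 -> x \is a GRing.unit) ->
  (forall x : A, (forall y, x * y = y * x) -> exists k : K, x = k%:A) ->
  (* Delta is a maximal R-order in A *)
  max_order R Delta ->
  (* Delta / rad Delta ~= M_r(D) for a division ring D *)
  (exists (D : unitRingType) (phi : A -> 'M[D]_r),
        (forall x : D, x != 0 -> x \is a GRing.unit)
     /\ (forall x y, Delta x -> Delta y -> phi (x + y) = phi x + phi y)
     /\ (forall x y, Delta x -> Delta y -> phi (x * y) = phi x * phi y)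
     /\ phi 1 = 1
     /\ (forall z, exists x, Delta x /\ phi x = z)
     /\ (forall x, Delta x -> (phi x = 0 <-> jrad Delta x))) ->
  (0 < n)%N ->
  (* Lambda is a normal hereditary R-order in M_n(A), contained in M_n(Delta) *)
  (forall M, Lambda M -> mx_over Delta M) ->
  is_order (@mx_scale K A n) R Lambda ->
  normal_order Lambda ->
  hereditary Lambda ->
  num_simple_classes Lambda d ->
  exists b c : nat, [/\ (b %| r)%N, (0 < c)%N &
    ring_iso (@mx_over _ b Lambda) (@mx_over _ c (@Delta_d K A Delta d))].
Proof.
move=> [sR _ [p pR]] _ _ [oD0 _] [D [phi [divD [phiD [phiM [phi1 [phi_surj phiP]]]]]]].
move=> n_gt0 LamD oL0 normL [herL _] dL.
have homP : residue_hom Delta (jrad Delta) phi by split.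
have oD := central_order_in_alg oD0; have oL := central_order_mx oL0.
have sD : subring_of Delta by case: oD.
have JD a : jrad Delta a -> Delta a by case.
have mJ := jrad_lsubmodule sD; have [gJ _] := mJ.
have qJ := jrad_quasiregular sR pR (@in_algC K A) oD.
have nJ1 := quasiregular_proper qJ (fun E => negP (oner_neq0 A) (introT eqP E)).
have Jp := mx_in_scalar (n := n) gJ (jrad_uniformizer sR pR (@in_algC K A) oD).
have [x [xV [Jx xxV xVx radL]]] := normal_order_generator (@mx_iotaC K A n) oL normL.
have xD : mx_over Delta x by case: Jx => /LamD.
have [d_gt0 chain_d stabL] := radical_chain_structure sR pR (@mx_iotaC K A n) oL
  (mx_over_subring n sD) LamD (mx_over_clear_denominators sR pR oD0 oL)
  (mx_residue_largest_ideal sD JD homP divD qJ n_gt0 nJ1)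
  (mx_quasiregular sD JD mJ qJ) Jp xxV xVx radL herL dL.
exact: (chain_stabilizer_iso sD JD nJ1 qJ divD homP n_gt0 d_gt0 xD xVx chain_d stabL).
Qed.
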